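(* For every $\varepsilon>0$ and every positive integer $q$ there exists an integer $k_0$ such that for every $k\ge k_0$ and every $r$ with $k-q\le r\le k$, every $k$-uniform hypergraph with $m$ edges has an $r$-cut of surplus $\Omega(m^{2/3-\varepsilon})$ (the implicit constant depending on $k$ and $\varepsilon$).
   Context: An $r$-cut of a $k$-uniform hypergraph is a partition of its vertex set into $r$ parts; its size is the number of edges with at least one vertex in each part. The surplus of an $r$-cut in a $k$-uniform hypergraph with $m$ edges is its size minus $\frac{S(k,r)\,r!}{r^k}m$, with $S(k,r)$ the Stirling number of the second kind. *)

(* Defs.v *)
From HB Require Import structures.
From mathcomp Require Import all_boot all_order all_algebra.
From mathcomp Require Import reals exp.

Set Implicit Arguments.
Unset Strict Implicit.
Unset Printing Implicit Defensive.

Import Order.TTheory GRing.Theory Num.Theory.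

Definition stirling2 (k r : nat) : nat :=
  #|[set P : {set {set 'I_k}} | partition P [set: 'I_k] & #|P| == r]|.

(* A hypergraph on the finite vertex set T is its set of edges
   E : {set {set T}}; in particular there are no repeated edges. *)
Definition uniform (T : finType) (k : nat) (E : {set {set T}}) : Prop :=
  forall e : {set T}, e \in E -> #|e| = k.

(* As finset.partition excludes set0, the r parts are nonempty. *)
Definition is_cut (T : finType) (r : nat) (P : {set {set T}}) : bool :=
  partition P [set: T] && (#|P| == r).

Definition cut_size (T : finType) (E P : {set {set T}}) : nat :=
  #|[set e in E | [forall B in P, e :&: B != set0]]|.

Local Open Scope ring_scope.

Definition surplus (R : realType) (T : finType) (k r : nat)
    (E P : {set {set T}}) : R :=
  (cut_size E P)%:R - (stirling2 k r * r`!)%:R / r%:R ^+ k * #|E|%:R.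

(* Main.v *)
(** Colour the vertices uniformly at random with [r] colours: the mean number of
    rainbow edges is at least [S(k,r) r! / r^k] times [m], and one must beat it.
    Tilting the uniform distribution, so that the vertices [u] of a set [A] carrying
    one of the first two colours are recoloured with a small bias [b_u] depending on
    the colours outside [A], changes the mean by a sum over edges [e] and nonempty
    [U \subset A :&: e] of correlations of "[e] is rainbow" with the biases
    on [U]; the part [#|U| = 1] is the gain, the rest must be shown to be smaller.

    Let [W] be the set of vertices of degree above [m^(2/3)], so [#|W| = O(m^(1/3))].
    If half of the edges have two vertices in [W], biasing each vertex of
    [W :&: A] against the average colour of [W :\: A] gains about
    [m / #|W| >= m^(2/3)].

    Otherwise look, in each edge, at the largest degree of a subset of size [Q^j], for
    [j <= L]. These [L + 1] degrees lie between [1] and [m], so for some [j] they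
    grow by a factor of at most [m^(1/L)] from size [Q^(j+1)] to size [Q^j]. Then a
    maximal family [F] of the subsets of size [Q^(j+1)] found in this way, subject to
    pairwise intersections smaller than [Q^j], still has total degree about [m]. The
    bias of [u] is a small multiple of the sum, over the [T \in F] assigned to [u], of
    a product of mean-zero functions of the colours of [T :\ u]. The sum over
    [#|U| = 1] gains [1] for each pair [T \subset e]. A correlation involving several
    members of [F] vanishes as soon as one of them has a vertex outside [e] and
    outside the others, so by sparseness each member must meet [e] in at least [Q^j]
    vertices and there are only boundedly many choices. For the same reason the
    moments of the biases are those of independent signs. As [u] lies in at most
    [O(m^(2/3))] members of [F], biases of order [m^(-1/3)] are allowed, and the gain
    is [m^(2/3)] up to a small power. The assumption [k - q <= r] enters because an
    edge with more than [q + 2] vertices in the first two colours is never rainbow,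
    which bounds [#|U|] independently of [k]. *)
Require Import Defs.
From HB Require Import structures.
From mathcomp Require Import all_boot all_order all_algebra all_fingroup.
From mathcomp Require Import boolp reals exp ring lra zify.

Set Implicit Arguments.
Unset Strict Implicit.
Unset Printing Implicit Defensive.

Import Order.TTheory GRing.Theory Num.Theory.

(** * Counting rainbow colourings *)

Definition rainbow (V : finType) (r : nat) (e : {set V}) (x : {ffun V -> 'I_r}) :=
  [forall c, exists v in e, x v == c].

Lemma rainbowP (V : finType) (r : nat) (e : {set V}) (x : {ffun V -> 'I_r}) :
  reflect (forall c, exists2 v, v \in e & x v = c) (rainbow e x).
Proof.
apply: (iffP forallP) => [h c | h c].
  by have /existsP[v /andP[ve /eqP xv]] := h c; exists v.
by have [v ve xv] := h c; apply/existsP; exists v; rewrite ve xv eqxx.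
Qed.

Lemma eq_rainbow (V : finType) (r : nat) (e : {set V}) (x y : {ffun V -> 'I_r}) :
  {in e, x =1 y} -> rainbow e x = rainbow e y.
Proof.
move=> xy; apply: eq_forallb => c; apply: eq_existsb => v.
by case ve: (v \in e) => //=; rewrite xy.
Qed.

(** The parts are the colour classes; the rainbow edge [e0] makes all [r] of them nonempty, as
    [partition] demands. *)
Lemma cut_of_coloring (V : finType) (r : nat) (E : {set {set V}})
    (x : {ffun V -> 'I_r}) (e0 : {set V}) : rainbow e0 x ->
  exists2 P : {set {set V}}, is_cut r P &
    cut_size E P = #|[set e in E | rainbow e x]|.
Proof.
move=> /rainbowP sx; pose B c := [set v | x v == c].
have Bx v c : (v \in B c) = (x v == c) by rewrite inE.
have B0 c : B c != set0.
  by have [v _ xv] := sx c; apply/set0Pn; exists v; rewrite Bx xv.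
have Binj : injective B.
  move=> c d Bcd; have [v] := set0Pn _ (B0 c) => vc.
  by have := vc; rewrite Bcd; move: vc; rewrite !Bx => /eqP-> /eqP.
exists [set B c | c : 'I_r].
  apply/andP; split; last by rewrite card_imset // card_ord.
  apply/and3P; split.
  - rewrite eqEsubset subsetT /=; apply/subsetP => v _.
    by apply/bigcupP; exists (B (x v)); rewrite ?imset_f ?Bx.
  - apply/trivIsetP => _ _ /imsetP[c _ ->] /imsetP[d _ ->] ncd.
    rewrite -setI_eq0; apply/eqP/setP => v; rewrite !inE.
    apply/negP => /andP[/eqP xc /eqP xd].
    by rewrite -xc -xd eqxx in ncd.
  - by apply/imsetP => -[c _ /esym/eqP]; rewrite (negbTE (B0 c)).
rewrite /cut_size; apply: eq_card => e; rewrite !inE; congr (_ && _).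
apply/forall_inP/rainbowP => [h c | h _ /imsetP[c _ ->]].
  have /set0Pn[v] := h _ (imset_f B (erefl : c \in predT)).
  by rewrite inE Bx => /andP[ve /eqP xv]; exists v.
by have [v ve xv] := h c; apply/set0Pn; exists v; rewrite inE ve Bx xv eqxx.
Qed.

(** A partition with enumerated blocks and a permutation of the colours give a surjective colouring,
    and both can be recovered from it: the blocks are the colour classes. *)
Lemma stirling2_surj (k r : nat) : 0 < r ->
  stirling2 k r * r`! <= #|[set x : {ffun 'I_k -> 'I_r} | rainbow setT x]|.
Proof.
case: r => // r _.
have -> : r.+1`! = #|[set: 'S_r.+1]| by rewrite cardsT card_Sn.
rewrite -cardsX.
set D := setX _ _.
pose idx (P : {set {set 'I_k}}) i := index (pblock P i) (enum P).
pose f (Q : {set {set 'I_k}} * 'S_r.+1) :=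
  [ffun i : 'I_k => Q.2 (inord (idx Q.1 i))].
have idx_lt P i : partition P [set: 'I_k] -> #|P| = r.+1 -> idx P i < r.+1.
  move=> pP cP; rewrite -cP cardE index_mem mem_enum pblock_mem //.
  by rewrite (cover_partition pP) inE.
have idx_surj P (c : 'I_r.+1) : partition P [set: 'I_k] -> #|P| = r.+1 ->
    exists i, inord (idx P i) = c.
  move=> pP cP; have cs : c < size (enum P) by rewrite -cardE cP.
  have BP : nth set0 (enum P) c \in P by rewrite -mem_enum mem_nth.
  have [i iB] := set0Pn _ (partition_neq0 pP BP).
  exists i; rewrite /idx (def_pblock _ BP iB) ?(partition_trivIset pP) //.
  by rewrite index_uniq ?enum_uniq ?inord_val.
rewrite -(@card_in_imset _ _ f D).
  apply: subset_leq_card; apply/subsetP => y /imsetP[[P s]].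
  rewrite !inE andbT => /andP[pP /eqP cP] -> {y}.
  apply/rainbowP => c; have [i hi] := idx_surj P (s^-1%g c) pP cP.
  by exists i; rewrite ?inE // ffunE /= hi permKV.
move=> [P s] [P' s']; rewrite !inE !andbT /=.
move=> /andP[pP /eqP cP] /andP[pP' /eqP cP'] ff.
have same (Q : {set {set 'I_k}}) u i j : partition Q [set: 'I_k] -> #|Q| = r.+1 ->
    (f (Q, u) i == f (Q, u) j) = (j \in pblock Q i).
  move=> pQ cQ; rewrite !ffunE /= (inj_eq perm_inj) -val_eqE /= !inordK ?idx_lt //.
  have Qc v : v \in cover Q by rewrite (cover_partition pQ).
  rewrite -(eq_pblock _ (partition_trivIset pQ) (Qc i)).
  rewrite /idx; apply/eqP/eqP => [|-> //]; apply: (index_inj set0).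
    by rewrite mem_enum pblock_mem.
  by rewrite mem_enum pblock_mem.
have PP' : P = P'.
  rewrite -(equivalence_partition_pblock pP) -(equivalence_partition_pblock pP').
  rewrite /equivalence_partition; apply: eq_imset => i.
  by apply/setP => j; rewrite !inE /= -(same P s) // -(same P' s') // ff.
rewrite -{P' pP' cP'}PP' in ff *; congr pair; apply/permP => c.
have [i hi] := idx_surj P c pP cP.
by have := congr1 (fun g : {ffun _} => g i) ff; rewrite !ffunE /= hi.
Qed.

Lemma card_extensions (V : finType) (r : nat) (e : {set V}) (x0 : {ffun V -> 'I_r}) :
  #|[set x : {ffun V -> 'I_r} | [forall v in e, x v == x0 v]]| = r ^ (#|V| - #|e|).
Proof.
pose F v : pred 'I_r := if v \in e then pred1 (x0 v) else predT.
rewrite (@eq_card _ _ (family F)); last first.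
  move=> x; rewrite inE; apply/forall_inP/familyP => h v.
    by rewrite /F; case: ifP => // ve; rewrite inE h.
  by move=> ve; have := h v; rewrite /F ve inE.
rewrite card_family foldrE big_map big_enum /= (bigID (mem e)) /=.
rewrite big1 => [|v ve]; last by rewrite /F ve card1.
rewrite mul1n (eq_bigr (fun=> r)) => [|v /negbTE ve]; last first.
  by rewrite /F ve card_ord.
rewrite prod_nat_const; congr expn.
by rewrite -(cardsC e) addKn; apply: eq_card => v; rewrite !inE.
Qed.

(** Being rainbow on [e] depends only on the restriction [res] to [e], and every restriction has
    [r ^ (#|V| - #|e|)] extensions. *)
Lemma stirling2_rainbow (V : finType) (r : nat) (e : {set V}) : 0 < r ->
  stirling2 #|e| r * r`! * r ^ (#|V| - #|e|)
    <= #|[set x : {ffun V -> 'I_r} | rainbow e x]|.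
Proof.
case: r => // r r0; apply: leq_trans (leq_mul (stirling2_surj _ r0) (leqnn _)) _.
pose res (x : {ffun V -> 'I_r.+1}) := [ffun i : 'I_#|e| => x (enum_val i)].
rewrite -[X in _ <= X]sum1_card -[X in X * _]sum1_card (partition_big res (mem [set x | rainbow
  setT x])) /=.
  rewrite big_distrl /=; apply: leq_sum => y; rewrite inE => sy.
  have [x0 x0P] : exists x0 : {ffun V -> 'I_r.+1}, res x0 = y.
    have [e0|[v0 v0e]] := set_0Vmem e.
      exists [ffun => ord0]; apply/ffunP => i.
      have ei := enum_valP i; have : enum_val i \in set0 by rewrite -e0.
      by rewrite inE.
    exists [ffun v => y (enum_rank_in v0e v)]; apply/ffunP => i.
    by rewrite !ffunE enum_valK_in.
  rewrite mul1n -(card_extensions e x0) -sum1_card; apply: eq_leq.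
  apply: eq_bigl => x; rewrite !inE; apply/idP/idP => [h | /andP[_ /eqP xy]].
    have xy : res x = y.
      rewrite -x0P; apply/ffunP => i; rewrite !ffunE.
      by apply/eqP; rewrite (forall_inP h) ?enum_valP.
    rewrite xy eqxx andbT; apply/rainbowP => c.
    by have [i _ <-] := rainbowP _ _ sy c; exists (enum_val i); rewrite ?enum_valP -?xy ?ffunE.
  apply/forall_inP => v ve; have := congr1 (fun g : {ffun _} => g (enum_rank_in ve v)) (etrans
    xy (esym x0P)).
  by rewrite !ffunE enum_rankK_in // => ->.
move=> x; rewrite !inE => /rainbowP sx; apply/rainbowP => c.
have [v ve xv] := sx c; exists (enum_rank_in ve v); rewrite ?inE //.
by rewrite ffunE enum_rankK_in.
Qed.

Local Open Scope ring_scope.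

(** * Averages over colourings and tilting *)

Section Averages.
Variables (R : realType) (V : finType) (r : nat).
Implicit Types (x : {ffun V -> 'I_r.+1}) (F G : {ffun V -> 'I_r.+1} -> R).

Definition avg F : R := (\sum_x F x) / (#|{: {ffun V -> 'I_r.+1}}|)%:R.

Lemma card_colorings_gt0 : 0 < (#|{: {ffun V -> 'I_r.+1}}|)%:R :> R.
Proof. by rewrite ltr0n; apply/card_gt0P; exists [ffun=> ord0]. Qed.

Lemma eq_avg F G : F =1 G -> avg F = avg G.
Proof. by move=> FG; rewrite /avg (eq_bigr G). Qed.

Lemma avg_sum (I : Type) (s : seq I) (P : pred I) (F : I -> _ -> R) :
  avg (fun x => \sum_(i <- s | P i) F i x) = \sum_(i <- s | P i) avg (F i).
Proof. by rewrite /avg exchange_big /= mulr_suml. Qed.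

Lemma avgZ c F : avg (fun x => c * F x) = c * avg F.
Proof. by rewrite /avg -mulr_sumr mulrA. Qed.

Lemma avgB F G : avg (fun x => F x - G x) = avg F - avg G.
Proof. by rewrite /avg sumrB mulrBl. Qed.

Lemma avg_cst c : avg (fun=> c) = c.
Proof.
by rewrite /avg sumr_const -[c *+ _]mulr_natr; apply: mulfK; rewrite gt_eqF // card_colorings_gt0.
Qed.

Lemma avg0 : avg (fun=> 0) = 0. Proof. exact: avg_cst. Qed.

Lemma ler_avg F G : (forall x, F x <= G x) -> avg F <= avg G.
Proof.
by move=> FG; rewrite ler_pM2r ?invr_gt0 ?card_colorings_gt0 // ler_sum.
Qed.

Lemma ler_norm_avg F : `|avg F| <= avg (fun x => `|F x|).
Proof.
rewrite normrM [X in _ * X]ger0_norm ?invr_ge0 ?ler0n //.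
by rewrite ler_wpM2r ?invr_ge0 ?ler0n // ler_norm_sum.
Qed.

(* The colours [2 i] and [2 i + 1], provided [2 i + 1 <= r]: otherwise [inord] is [ord0]. *)
Definition pole0 i : 'I_r.+1 := inord i.*2.
Definition pole1 i : 'I_r.+1 := inord i.*2.+1.

Definition dipole i (c : 'I_r.+1) : R := (c == pole0 i)%:R - (c == pole1 i)%:R.

Definition flip (v : V) i x : {ffun V -> 'I_r.+1} :=
  [ffun w => if w == v then tperm (pole0 i) (pole1 i) (x w) else x w].

Lemma flipE v i x w :
  flip v i x w = if w == v then tperm (pole0 i) (pole1 i) (x w) else x w.
Proof. by rewrite ffunE. Qed.

Lemma flip_neq v i x w : w != v -> flip v i x w = x w.
Proof. by rewrite flipE => /negbTE ->. Qed.

Lemma flipK v i : involutive (flip v i).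
Proof.
by move=> x; apply/ffunP => w; rewrite !flipE; case: eqP => // _; rewrite tpermK.
Qed.

Lemma rainbow_flip (e : {set V}) v i x : v \notin e -> rainbow e (flip v i x) = rainbow e x.
Proof.
move=> ve; apply: eq_rainbow => w we; apply: flip_neq.
by apply: contraNneq ve => <-.
Qed.

Lemma dipole_tperm i c : dipole i (tperm (pole0 i) (pole1 i) c) = - dipole i c.
Proof.
rewrite /dipole; have [->|->|/eqP/negbTE-> /eqP/negbTE->] := tpermP; last first.
- by rewrite subrr oppr0.
- by rewrite !eqxx [pole0 i == _]eq_sym opprB.
- by rewrite !eqxx [pole1 i == _]eq_sym opprB.
Qed.

Lemma dipole_flip v i x : dipole i (flip v i x v) = - dipole i (x v).
Proof. by rewrite flipE eqxx dipole_tperm. Qed.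

Lemma dipole_norm i c : `|dipole i c| <= 1.
Proof.
by rewrite /dipole; do 2!case: (_ == _); rewrite ?subrr ?subr0 ?sub0r ?normrN ?normr1 ?normr0
  // ler01.
Qed.

Lemma avg_flip v i F : avg (fun x => F (flip v i x)) = avg F.
Proof. by rewrite /avg [in RHS](reindex_inj (inv_inj (flipK v i))). Qed.

(** A flip permutes the colourings, so it preserves the mean. The vanishing means below come from
    such flips. *)
Lemma avg_odd v i F : (forall x, F (flip v i x) = - F x) -> avg F = 0.
Proof.
move=> oddF; have := avg_flip v i F; rewrite (eq_avg oddF).
have -> : avg (fun x => - F x) = - avg F.
  by rewrite -mulN1r -avgZ; apply: eq_avg => x; rewrite mulN1r.
by move=> h; lra.
Qed.

(* Reweight the uniform colouring by [\prod_(u in A) (1 + dipole 0 (x u) * b u x)],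
   a probability density because [b] does not look at [A]: this recolours the
   vertices of [A] having one of the first two colours with bias [b]. *)
Lemma tilt (E : {set {set V}}) (A : {set V}) (b : V -> {ffun V -> 'I_r.+1} -> R) :
    {in A, forall u x, `|b u x| <= 1} ->
    {in A &, forall u v x, b u (flip v 0 x) = b u x} ->
  exists x, \sum_(e in E) \sum_(U : {set V} | U \subset A :&: e)
      avg (fun x => (rainbow e x)%:R * \prod_(u in U) (dipole 0 (x u) * b u x))
    <= (#|[set e in E | rainbow e x]|)%:R.
Proof.
move=> b1 bA; pose g u x := if u \in A then dipole 0 (x u) * b u x else 0.
pose W x := \prod_u (g u x + 1).
have WE x : W x = \sum_(U : {set V}) \prod_(u in U) g u x.
  by rewrite /W bigA_distr; apply: eq_bigr => U _; rewrite [RHS]big_mkcond.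
have W0 x : 0 <= W x.
  apply: prodr_ge0 => u _; rewrite /g; case: ifP => uA; last by rewrite add0r.
  rewrite -lerBlDr sub0r lerNl; apply: le_trans (ler_norm _) _.
  by rewrite normrN normrM mulr_ile1 ?normr_ge0 ?dipole_norm ?b1.
have gU (U : {set V}) x : U \subset A ->
    \prod_(u in U) g u x = \prod_(u in U) (dipole 0 (x u) * b u x).
  by move=> /subsetP UA; apply: eq_bigr => u uU; rewrite /g UA.
have gN (U : {set V}) x : ~~ (U \subset A) -> \prod_(u in U) g u x = 0.
  by move=> /subsetPn[u uU uA]; rewrite (bigD1 u) //= /g (negbTE uA) mul0r.
(* A vertex of [U] outside [e] enters only through its own dipole, which changes sign; [b] is
   unchanged by flips inside [A]. *)
have van (e U : {set V}) : U \subset A -> ~~ (U \subset e) ->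
    avg (fun x => (rainbow e x)%:R * \prod_(u in U) g u x) = 0.
  move=> UA /subsetPn[u uU ue]; apply: (@avg_odd u 0%N) => x.
  rewrite rainbow_flip // -mulrN !gU // (bigD1 u) //= [in RHS](bigD1 u) //=.
  rewrite dipole_flip !mulNr; congr (_ * - (_ * _ * _)).
    by rewrite bA ?(subsetP UA).
  apply: eq_bigr => w /andP[wU wu].
  by rewrite flip_neq // bA ?(subsetP UA).
(* Only [U = set0] survives in the expansion, so [W] is a probability density. *)
have avgW : avg W = 1.
  rewrite (eq_avg WE) avg_sum (bigD1 set0) //= big1 => [|U U0].
    by rewrite addr0 -[RHS]avg_cst; apply: eq_avg => x; rewrite big_set0.
  case UA: (U \subset A); last first.
    by rewrite -[RHS]avg0; apply: eq_avg => x; rewrite gN ?UA.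
  have [u uU] := set0Pn _ U0.
  apply: (@avg_odd u 0%N) => x; rewrite !gU // (bigD1 u) //= [in RHS](bigD1 u) //=.
  rewrite dipole_flip !mulNr; congr (- (_ * _ * _)).
    by rewrite bA ?(subsetP UA).
  apply: eq_bigr => w /andP[wU wu].
  by rewrite flip_neq // bA ?(subsetP UA).
pose f x := (#|[set e in E | rainbow e x]|)%:R : R.
have fE x : f x = \sum_(e in E) (rainbow e x)%:R.
  rewrite /f -sum1_card natr_sum [RHS](bigID (fun e => rainbow e x)) /=.
  rewrite [X in _ + X]big1 => [|e /andP[_ /negbTE->] //]; rewrite addr0.
  by apply: eq_big => e; rewrite ?inE // => /andP[_ ->].
(* The maximum number of rainbow edges is at least the [W]-weighted mean. *)
have [x _ xmax] := @Order.TotalTheory.arg_maxP _ _ _ ([ffun=> ord0] : {ffun V -> 'I_r.+1})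
  predT f isT.
exists x; have -> : (#|[set e in E | rainbow e x]|)%:R = avg (fun y => f x * W y) :> R.
  by rewrite avgZ avgW mulr1.
have fW : avg (fun y => f y * W y) <= avg (fun y => f x * W y).
  by apply: ler_avg => y; rewrite ler_wpM2r //; apply: xmax.
apply: le_trans _ fW.
rewrite (@eq_avg _ (fun y => \sum_(e in E) \sum_(U : {set V})
   (rainbow e y)%:R * \prod_(u in U) g u y)); last first.
  by move=> y; rewrite fE mulr_suml; apply: eq_bigr => e _; rewrite WE mulr_sumr.
rewrite avg_sum; apply: ler_sum => e _; rewrite avg_sum le_eqVlt; apply/orP; left.
apply/eqP; rewrite [in RHS](bigID (fun U : {set V} => U \subset A :&: e)) /=.
rewrite [X in _ + X]big1 ?addr0 => [|U].
  apply: eq_bigr => U; rewrite subsetI => /andP[UA Ue].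
  by apply: eq_avg => y; rewrite gU.
rewrite subsetI negb_and; case UA: (U \subset A) => /= Ue; first exact: van.
by rewrite -[RHS]avg0; apply: eq_avg => y; rewrite gN ?UA ?mulr0.
Qed.

End Averages.

(** * The top coefficient of an edge *)

Section TopCoefficient.
Variables (R : realType) (V : finType) (r h : nat) (e : {set V}) (a b : nat -> V).
Hypothesis (hr : (h.*2 <= r.+1)%N).
Hypothesis (ae : forall i, (i < h)%N -> a i \in e).
Hypothesis (be : forall i, (i < h)%N -> b i \in e).
Hypothesis (ab : forall i j, (i < h)%N -> (j < h)%N -> a i != b j).
Hypothesis (bb : forall i j, (i < h)%N -> (j < h)%N -> i != j -> b i != b j).
Implicit Types (x : {ffun V -> 'I_r.+1}).

Let p0 := @pole0 r.
Let p1 := @pole1 r.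

Let p01 i j : (i < h)%N -> (j < h)%N -> (p0 i == p1 j) = false.
Proof. by move=> ih jh; rewrite -val_eqE /= !inordK; lia. Qed.

Let p00 i j : (i < h)%N -> (j < h)%N -> (p0 i == p0 j) = (i == j).
Proof. by move=> ih jh; rewrite -val_eqE /= !inordK; lia. Qed.

Let p11 i j : (i < h)%N -> (j < h)%N -> (p1 i == p1 j) = (i == j).
Proof. by move=> ih jh; rewrite -val_eqE /= !inordK; lia. Qed.

(** Flipping [b i] exchanges [same] and [diff], whose difference is [weight]; [good] describes what
    survives the cancellation. *)
Let same i x := (x (a i) == x (b i)) && (x (b i) \in [:: p0 i; p1 i]).
Let diff i x := (x (a i) == tperm (p0 i) (p1 i) (x (b i))) && (x (b i) \in [:: p0 i; p1 i]).
Let good i x := diff i x && [forall v in e, (v != b i) ==> (x v != x (b i))].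

Let weight i x : R := - (dipole R i (x (a i)) * dipole R i (x (b i))).

Let weightE i x : (i < h)%N -> weight i x = (diff i x)%:R - (same i x)%:R.
Proof.
move=> ih; rewrite /weight /diff /same !inE /dipole -/(p0 i) -/(p1 i).
have n01 := p01 ih ih; have n10 : p1 i == p0 i = false by rewrite eq_sym.
case: tpermP => [->|->|/eqP/negbTE-> /eqP/negbTE->].
- rewrite eqxx n01 /= !andbT; have [->|_] := eqVneq (x (a i)) (p0 i).
    by rewrite n01 /=; lra.
  by case: (_ == _) => /=; lra.
- rewrite eqxx n10 /= !andbT; have [->|_] := eqVneq (x (a i)) (p0 i).
    by rewrite n01 /=; lra.
  by case: (_ == _) => /=; lra.
- by rewrite !andbF /=; lra.
Qed.

Let fl j x := flip (b j) j x.

Let fl_a i j x : (i < h)%N -> (j < h)%N -> fl j x (a i) = x (a i).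
Proof. by move=> ih jh; rewrite /fl flip_neq // ab. Qed.

Let fl_b i j x : (i < h)%N -> (j < h)%N -> i != j -> fl j x (b i) = x (b i).
Proof. by move=> ih jh ij; rewrite /fl flip_neq // bb. Qed.

Let fl_bb j x : fl j x (b j) = tperm (p0 j) (p1 j) (x (b j)).
Proof. by rewrite /fl flipE eqxx. Qed.

Let mem_fl j x : (tperm (p0 j) (p1 j) (x (b j)) \in [:: p0 j; p1 j]) = (x (b j) \in [:: p0 j;
  p1 j]).
Proof.
case: tpermP => [->|->|/eqP/negbTE E0 /eqP/negbTE E1]; by rewrite ?inE ?eqxx ?orbT ?E0 ?E1.
Qed.

Let same_fl j x : (j < h)%N -> same j (fl j x) = diff j x.
Proof. by move=> jh; rewrite /same /diff fl_a // fl_bb mem_fl. Qed.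

Let weight_fl i j x : (i < h)%N -> (j < h)%N -> i != j -> weight i (fl j x) = weight i x.
Proof. by move=> ih jh ij; rewrite /weight fl_a // fl_b. Qed.

Let good_fl i j x : (i < h)%N -> (j < h)%N -> i != j -> good i (fl j x) = good i x.
Proof.
move=> ih jh ij; rewrite /good.
have -> : diff i (fl j x) = diff i x by rewrite /diff fl_a // fl_b.
rewrite fl_b //; case di: (diff i x) => //=; have /andP[_ xb] := di.
apply: eq_forallb => v; case: (v \in e) => //=; case: (v != b i) => //=.
have [->|vb] := eqVneq v (b j); last by rewrite /fl flip_neq.
rewrite fl_bb; congr negb; have E : tperm (p0 j) (p1 j) (x (b i)) = x (b i).
  rewrite tpermD //; move: xb; rewrite !inE => /orP[]/eqP->.
  - by rewrite p00 // eq_sym.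
  - by rewrite p01.
  - by rewrite eq_sym p01.
  - by rewrite p11 // eq_sym.
by rewrite -{1}E (inj_eq perm_inj).
Qed.

(** After the flip [b j] repeats the colour of [a j], so the edge stops being rainbow exactly when
    no other vertex has the old colour of [b j]. *)
Let rainbow_fl j x : (j < h)%N -> diff j x ->
  rainbow e x && ~~ rainbow e (fl j x) = rainbow e x && good j x.
Proof.
move=> jh dj; rewrite /good dj /=; case re: (rainbow e x) => //=.
have /andP[/eqP xa _] := dj.
apply/idP/forall_inP => [nr v ve | uq].
  apply/implyP => vb; apply: contra nr => /eqP xv; apply/rainbowP => c.
  have [w we xw] := rainbowP _ _ re c.
  have [wb|wb] := eqVneq w (b j); last by exists w; rewrite // /fl flip_neq.
  by exists v => //; rewrite /fl flip_neq // xv -wb.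
apply/rainbowP => /(_ (x (b j)))[v ve].
have [->|vb] := eqVneq v (b j).
  rewrite fl_bb -xa => xab; have := uq _ (ae jh).
  by rewrite ab //= xab eqxx.
by rewrite /fl flip_neq // => xv; have := uq _ ve; rewrite vb xv eqxx.
Qed.

Let rainbow_fl_le j x : (j < h)%N -> diff j x -> rainbow e (fl j x) -> rainbow e x.
Proof.
move=> jh /andP[/eqP xa _] /rainbowP rf; apply/rainbowP => c.
have [w we <-] := rf c; have [->|wb] := eqVneq w (b j).
  by exists (a j); rewrite ?ae // fl_bb -xa.
by exists w; rewrite // /fl flip_neq.
Qed.

(** Interpolates between the product of the weights, at [j = 0], and the product of the indicators
    of [good], at [j = h]. *)
Let partial j x := \prod_(i < h) (if (i < j)%N then (good i x)%:R else weight i x).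

(** Substituting the flip into the [same] half of the weight leaves, on [diff j], the rainbow
    indicator before the flip minus the one after it. This is the indicator of [good j] among
    rainbow colourings. *)
Let partial_step j : (j < h)%N ->
  avg (fun x => (rainbow e x)%:R * partial j x)
    = avg (fun x => (rainbow e x)%:R * partial j.+1 x).
Proof.
move=> jh; pose o := Ordinal jh.
pose rest x := \prod_(i < h | i != o) (if (i < j)%N then (good i x)%:R else weight i x).
have p_j x : partial j x = weight j x * rest x.
  by rewrite /partial (bigD1 o) //= ltnn.
have p_Sj x : partial j.+1 x = (good j x)%:R * rest x.
  rewrite /partial (bigD1 o) //= ltnSn; congr (_ * _); apply: eq_bigr => i io.
  by rewrite ltnS leq_eqVlt -[i == j :> nat]/(i == o) (negbTE io).
have rest_fl x : rest (fl j x) = rest x.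
  apply: eq_bigr => i io; have ij : i != j :> nat by [].
  by rewrite good_fl // weight_fl.
have E1 : avg (fun x => (rainbow e x)%:R * partial j x)
    = avg (fun x => (rainbow e x)%:R * ((diff j x)%:R * rest x))
    - avg (fun x => (rainbow e x)%:R * ((same j x)%:R * rest x)).
  by rewrite -avgB; apply: eq_avg => x; rewrite p_j weightE //; ring.
have E2 : avg (fun x => (rainbow e x)%:R * ((same j x)%:R * rest x))
    = avg (fun x => (rainbow e (fl j x))%:R * ((diff j x)%:R * rest x)).
  rewrite -(avg_flip (b j) j); apply: eq_avg => x.
  by rewrite -/(fl j x) same_fl // rest_fl.
rewrite E1 E2 -avgB; apply: eq_avg => x; rewrite p_Sj -mulrBl !mulrA; congr (_ * _).
case dj: (diff j x); last by rewrite /good dj /= !mulr0.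
have := rainbow_fl jh dj; have := rainbow_fl_le jh dj.
case: (rainbow e x) (rainbow e (fl j x)) (good j x) => [] [] [] //=; try lra.
Qed.

(* Flipping the colour of [b i] cancels everything except the colourings in which,
   for every [i], [a i] and [b i] use the two poles of dipole [i] and no other
   vertex of [e] has the colour of [b i]. *)
Lemma top_coefficient (x0 : {ffun V -> 'I_r.+1}) :
    rainbow e x0 ->
    (forall i, (i < h)%N -> x0 (a i) = pole0 r i /\ x0 (b i) = pole1 r i) ->
    (forall i v, (i < h)%N -> v \in e -> v != b i -> x0 v != x0 (b i)) ->
  r.+1%:R ^- #|e| <= avg (fun x => (rainbow e x)%:R *
     \prod_(i < h) - (dipole R i (x (a i)) * dipole R i (x (b i)))).
Proof.
move=> re x0ab uq.
have -> : avg (fun x => (rainbow e x)%:R * \prod_(i < h) - (dipole R i (x (a i)) * dipole R i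
  (x (b i))))
    = avg (fun x => (rainbow e x)%:R * partial h x).
  have -> : avg (fun x => (rainbow e x)%:R * partial h x) = avg (fun x => (rainbow e x)%:R *
    partial 0 x).
    suff H j : (j <= h)%N -> avg (fun x => (rainbow e x)%:R * partial j x) = avg (fun x =>
      (rainbow e x)%:R * partial 0 x) by apply: H.
    by elim: j => // j IH jh; rewrite -partial_step // IH // ltnW.
  by [].
(* Colourings agreeing with [x0] on [e] contribute 1 and the others at least 0; the former make up a
   fraction [r.+1%:R ^- #|e|] of all. *)
have lb x : ([forall v in e, x v == x0 v])%:R <= (rainbow e x)%:R * partial h x.
  case ext: [forall v in e, _]; last first.
    apply: mulr_ge0; rewrite ?ler0n //; apply: prodr_ge0 => i _.
    by rewrite ltn_ord ler0n.
  have xe v : v \in e -> x v = x0 v by move=> ve; apply/eqP/(forall_inP ext).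
  rewrite (eq_rainbow (y := x0)) // re mul1r /partial big1 // => i _.
  have ih := ltn_ord i; have [xa xb] := x0ab _ ih.
  rewrite ih /good /diff !xe ?ae ?be // xa xb tpermR eqxx !inE eqxx orbT /=.
  suff -> : [forall v in e, (v != b i) ==> (x v != p1 i)] by [].
  apply/forall_inP => v ve; apply/implyP => vb.
  by rewrite xe // -[p1 i]xb uq.
apply: le_trans (ler_avg lb); rewrite /avg.
have -> : \sum_(x : {ffun V -> 'I_r.+1}) ([forall v in e, x v == x0 v])%:R = (r.+1 ^ (#|V| -
  #|e|))%:R :> R.
  rewrite -(card_extensions e x0) -sum1_card natr_sum [RHS]big_mkcond /=.
  by apply: eq_bigr => x _; rewrite inE; case: ifP.
rewrite card_ffun card_ord !natrX ler_pdivlMr ?exprn_gt0 ?ltr0n //.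
rewrite mulrC ler_pdivrMr ?exprn_gt0 ?ltr0n // -exprD subnK ?max_card //.
Qed.
End TopCoefficient.

Lemma prod_double (R : comNzRingType) (F : nat -> R) (h : nat) :
  \prod_(0 <= i < h.*2) F i = \prod_(i < h) (F i.*2 * F i.*2.+1).
Proof.
elim: h => [|h IH]; first by rewrite big_ord0 big_nil.
by rewrite doubleS !big_nat_recr //= IH big_ord_recr /= mulrA.
Qed.

(** Positions [2 i] and [2 i + 1] of [s] play the roles of [a i] and [b i]; the [h] minus signs give
    the factor [(-1) ^+ h]. *)
Lemma top_coefficient_seq (R : realType) (V : finType) (r h : nat) (e : {set V})
    (s : seq V) : uniq s -> size s = h.*2 -> {subset s <= e} -> (0 < h)%N ->
    (h.*2 <= r.+1)%N -> (r.+1 <= #|e|)%N ->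
  r.+1%:R ^- #|e| <= (-1) ^+ h * avg (fun x : {ffun V -> 'I_r.+1} =>
     (rainbow e x)%:R * \prod_(v <- s) dipole R (index v s)./2 (x v)).
Proof.
move=> us ss se h0 hr re.
have [v0 v0s] : exists v0, v0 \in s.
  by case: s ss {us se} => [|v s _]; [case: h h0 {hr} | exists v; rewrite inE eqxx].
pose a i := nth v0 s i.*2; pose b i := nth v0 s i.*2.+1.
have ai i : (i < h)%N -> (i.*2 < size s)%N by rewrite ss; lia.
have bi i : (i < h)%N -> (i.*2.+1 < size s)%N by rewrite ss; lia.
pose q := s ++ [seq v <- enum e | v \notin s].
have memq v : (v \in q) = (v \in e).
  rewrite mem_cat mem_filter mem_enum.
  by case vs: (v \in s) => //=; rewrite se.
have uq : uniq q.
  rewrite cat_uniq us filter_uniq ?enum_uniq // andbT /=.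
  by apply/hasPn => v; rewrite mem_filter => /andP[].
have sq : size q = #|e|.
  by rewrite cardE; apply: perm_size; apply: uniq_perm; rewrite ?enum_uniq // => v; rewrite
    memq mem_enum.
(* The colour is the position in [q], and 0 from position [r.+1] on. As 0 is the colour of [a 0],
   the colours of the [b i] stay unique. *)
pose x0 := [ffun v => inord (if (index v q < r.+1)%N then index v q else 0)] : {ffun V -> 'I_r.+1}.
have x0E v : x0 v = (if (index v q < r.+1)%N then index v q else 0) :> nat.
  by rewrite ffunE inordK //; case: ifP.
have idx i : (i < size s)%N -> index (nth v0 s i) q = i.
  by move=> ih; rewrite /q index_cat mem_nth // index_uniq.
have -> : (-1) ^+ h * avg (fun x : {ffun V -> 'I_r.+1} =>
     (rainbow e x)%:R * \prod_(v <- s) dipole R (index v s)./2 (x v))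
   = avg (fun x : {ffun V -> 'I_r.+1} => (rainbow e x)%:R *
     \prod_(i < h) - (dipole R i (x (a i)) * dipole R i (x (b i)))).
  rewrite -avgZ; apply: eq_avg => x; rewrite mulrCA; congr (_ * _).
  rewrite (big_nth v0) ss prod_double.
  rewrite (eq_bigr (fun i : 'I_h => dipole R i (x (a i)) * dipole R i (x (b i)))).
    by rewrite prodrN card_ord.
  move=> i _; have ih := ltn_ord i.
  by rewrite /a /b !index_uniq ?ai ?bi // (_ : i.*2.+1./2 = i) ?doubleK //; lia.
apply: (@top_coefficient R V r h e a b hr _ _ _ _ x0) => //.
- by move=> i ih; rewrite se // mem_nth ?ai.
- by move=> i ih; rewrite se // mem_nth ?bi.
- by move=> i j ih jh; rewrite nth_uniq ?ai ?bi //; lia.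
- by move=> i j ih jh ij; rewrite nth_uniq ?bi //; lia.
- apply/rainbowP => c; have cq : (c < size q)%N by rewrite sq; apply: leq_trans re.
  exists (nth v0 q c); first by rewrite -memq mem_nth.
  by apply: val_inj; rewrite /= x0E index_uniq // ltn_ord.
- move=> i ih; split; apply: val_inj; rewrite /= x0E idx ?ai ?bi // inordK; try lia.
  + by case: ifP; lia.
  + by case: ifP; lia.
- move=> i v ih ve vb; rewrite -val_eqE /= !x0E idx ?bi //.
  have ilt : (i.*2.+1 < r.+1)%N by lia.
  rewrite ilt; case: ifP => // _; apply: contra vb => /eqP vi.
  by rewrite -(nth_index v0 (_ : v \in q)) ?memq // vi /q nth_cat bi.
Qed.

(** * Random traces *)

(** Separates, in the sum of [tilt], the untilted mean, the first-order gain and the errors. *)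
Lemma sum_subsets (R : nmodType) (V : finType) (B : {set V}) (F : {set V} -> R) :
  \sum_(U : {set V} | U \subset B) F U
    = F set0 + \sum_(u in B) F [set u]
      + \sum_(U : {set V} | (U \subset B) && (1 < #|U|)%N) F U.
Proof.
rewrite (bigID (fun U : {set V} => (1 < #|U|)%N)) /= addrC; congr (_ + _).
rewrite (bigD1 set0) ?sub0set ?cards0 //=; congr (_ + _).
have <- : \sum_(U in [set [set u] | u in B]) F U = \sum_(u in B) F [set u].
  by rewrite big_imset //= => u v _ _ uv; apply/set1P; rewrite -uv set11.
apply: eq_bigl => U; apply/idP/imsetP => [/andP[/andP[UB U1] U0] | [u uB ->]].
  have /cards1P[u Uu] : #|U| == 1%N.
    by rewrite eqn_leq leqNgt U1 lt0n cards_eq0.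
  by exists u => //; rewrite -sub1set -Uu.
by rewrite sub1set uB cards1 /= -cards_eq0 cards1.
Qed.

Lemma card_trace1 (V : finType) (T : {set V}) (u : V) : u \in T ->
  (2 ^ #|V| <= 2 ^ #|T| * #|[set A : {set V} | T :&: A == [set u]]|)%N.
Proof.
move=> uT; rewrite -(cardsC T) expnD leq_mul2l; apply/orP; right.
rewrite -card_powerset -(@card_in_imset _ _ (fun B => u |: B)).
  apply: subset_leq_card; apply/subsetP => X /imsetP[B BT -> {X}]; move: BT; rewrite !inE => BT.
  apply/eqP/setP => v; rewrite !inE.
  have [->|_] /= := eqVneq v u; first by rewrite uT.
  by apply/negP => /andP[vT /(subsetP BT)]; rewrite inE vT.
have del B : B \in powerset (~: T) -> (u |: B) :\ u = B.
  rewrite inE => BT; apply: setU1K; apply/negP => /(subsetP BT).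
  by rewrite inE uT.
by move=> B B' hB hB' /(congr1 (fun X => X :\ u)); rewrite !del.
Qed.

(** Average over all [A]: by [card_trace1] each [i] is kept with probability at least
    [1 / 2 ^ t]. *)
Lemma exists_trace (V I : finType) (P : pred I) (w : I -> nat) (T : I -> {set V})
    (u : I -> V) (t : nat) :
    (forall i, P i -> u i \in T i) -> (forall i, P i -> (#|T i| <= t)%N) ->
  exists A : {set V},
    (\sum_(i | P i) w i <= 2 ^ t * \sum_(i | P i && (T i :&: A == [set u i])) w i)%N.
Proof.
move=> uT tT; pose S A := (\sum_(i | P i && (T i :&: A == [set u i])) w i)%N.
have [A _ maxA] := @arg_maxnP _ set0 predT S isT.
exists A; rewrite -/(S A) -(@leq_pmul2l #|{set V}|); last by apply/card_gt0P; exists set0.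
apply: (@leq_trans (2 ^ t * \sum_(A : {set V}) S A)); last first.
  rewrite mulnCA leq_mul2l; apply/orP; right.
  by rewrite -sum_nat_const; apply: leq_sum => B _; apply: maxA.
rewrite -sum_nat_const exchange_big /=.
rewrite (eq_bigr (fun A : {set V} => \sum_(i | P i) w i * (T i :&: A == [set u i])))%N; last first.
  move=> B _; rewrite /S big_mkcondr /=; apply: eq_bigr => i _.
  by case: ifP; rewrite ?muln1 ?muln0.
rewrite [X in (_ <= _ * X)%N]exchange_big /= big_distrr /=; apply: leq_sum => i Pi.
rewrite sum_nat_const -big_distrr /= mulnCA mulnC leq_mul2l; apply/orP; right.
have -> : (\sum_(B : {set V}) (T i :&: B == [set u i]) = #|[set B : {set V} | T i :&: B == [set
  u i]]|)%N.
  by rewrite -sum1_card [RHS]big_mkcond /=; apply: eq_bigr => B _; rewrite inE; case: ifP.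
rewrite -cardsT -powersetT card_powerset cardsT; apply: leq_trans (card_trace1 (uT i Pi)) _.
by rewrite leq_mul2r leq_exp2l // tT // orbT.
Qed.

(** * Many edges with two vertices of high degree *)

Section HeavyVertices.
Variables (R : realType) (V : finType) (r k : nat) (E : {set {set V}}) (W : {set V}).
Hypotheses (Ek : uniform k E) (r2 : (1 < r.+1)%N) (rk : (r.+1 <= k)%N).

Let rainbowR (e : {set V}) (x : {ffun V -> 'I_r.+1}) : R := (rainbow e x)%:R.
Let dip (v : V) (x : {ffun V -> 'I_r.+1}) : R := dipole R 0 (x v).
Let delta : R := r.+1%:R ^- k.

Lemma pair_coefficient (e : {set V}) (u v : V) : e \in E -> u != v -> u \in e -> v \in e ->
  delta <= - avg (fun x => rainbowR e x * (dip u x * dip v x)).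
Proof.
move=> eE uv ue ve; have us : uniq [:: u; v] by rewrite /= inE uv.
have se : {subset [:: u; v] <= e} by move=> w; rewrite !inE => /orP[]/eqP->.
have := @top_coefficient_seq R V r 1 e [:: u; v] us erefl se isT r2.
rewrite (Ek eE) => /(_ rk); rewrite expr1 mulN1r -/delta => h.
apply: le_trans h _; rewrite lerN2 le_eqVlt; apply/orP; left; apply/eqP.
by apply: eq_avg => x; rewrite 2!big_cons big_nil mulr1 /= eqxx (negbTE uv) eqxx.
Qed.

Lemma dip_pair0 (e : {set V}) (u v : V) : u != v -> v \notin e ->
  avg (fun x => rainbowR e x * (dip u x * dip v x)) = 0.
Proof.
move=> uv ve; apply: (@avg_odd _ _ _ v 0%N) => x.
by rewrite /rainbowR /dip rainbow_flip // flip_neq // dipole_flip !mulrN.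
Qed.

Lemma avg_sqr_dips (B : {set V}) : avg (fun x => (\sum_(v in B) dip v x) ^+ 2) <= (#|B|)%:R.
Proof.
rewrite (@eq_avg _ _ _ _ (fun x => \sum_(v in B) \sum_(w in B) dip v x * dip w x)); last first.
  by move=> x; rewrite expr2 mulr_suml; apply: eq_bigr => v _; rewrite mulr_sumr.
rewrite avg_sum -sum1_card natr_sum; apply: ler_sum => v vB.
rewrite avg_sum (bigD1 v) //= big1 => [|w /andP[_ wv]].
  rewrite addr0 -[leRHS](@avg_cst R V r); apply: ler_avg => x.
  apply: le_trans (ler_norm _) _; rewrite normrM mulr_ile1 ?normr_ge0 //; exact: dipole_norm.
apply: (@avg_odd _ _ _ w 0%N) => x.
by rewrite /dip dipole_flip flip_neq 1?eq_sym // mulrN.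
Qed.

(** All vertices of [A] share one bias, a negative multiple of the sum of the dipoles over [B]. A
    pair from [A] and [B] inside an edge gains [c * w * delta], while the second moment of the bias,
    at most [c ^+ 2 * w], bounds each error. *)
Lemma heavy_gain : exists x : {ffun V -> 'I_r.+1},
  \sum_(e in E) avg (rainbowR e)
    + delta ^+ 2 / (64%:R * 2 ^+ k) * ((#|[set e in E | (1 < #|W :&: e|)%N]|)%:R / (#|W|)%:R)
  <= (#|[set e in E | rainbow e x]|)%:R.
Proof.
pose I : finType := ({set V} * (V * V))%type.
pose P (i : I) := (i.1 \in E) && [&& i.2.1 \in W :&: i.1, i.2.2 \in W :&: i.1 & i.2.1 != i.2.2].
have uT i : P i -> i.2.1 \in [set i.2.1; i.2.2] by rewrite !inE eqxx.
have tT i : P i -> (#|[set i.2.1; i.2.2]| <= 2)%N by rewrite cards2; case: (_ != _).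
have [A0 hA0] := exists_trace (fun=> 1%N) uT tT.
pose A := A0 :&: W; pose B := W :\: A.
pose N (e : {set V}) := (\sum_(p : V * V | (p.1 \in A :&: e) && (p.2 \in B)) (p.2 \in e))%N.
have hN : (#|[set e in E | (1 < #|W :&: e|)%N]| <= 4 * \sum_(e in E) N e)%N.
  apply: leq_trans (leq_trans hA0 _).
    rewrite -sum1_card (partition_big (fun i : I => i.1) (mem [set e in E | (1 < #|W :&:
      e|)%N])) /=.
      apply: leq_sum => e; rewrite inE => /andP[eE /card_gt1P[u [v [uW vW uv]]]].
      by rewrite (bigD1 (e, (u, v))) //= eqxx andbT; apply/and4P.
    move=> i /andP[iE /and3P[uW vW uv]]; rewrite inE iE /=.
    by apply/card_gt1P; exists i.2.1, i.2.2.
  rewrite leq_mul2l /=; rewrite /N pair_big_dep /=.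
  rewrite big_mkcond [leqRHS]big_mkcond /=; apply: leq_sum => i _.
  case: ifP => // /andP[/andP[iE /and3P[]]]; rewrite !inE => /andP[uW ue] /andP[vW ve] uv tr.
  have uA : i.2.1 \in A0.
    have : i.2.1 \in [set i.2.1] by rewrite inE.
    by rewrite -(eqP tr) inE => /andP[].
  have vA : i.2.2 \notin A0.
    apply: contra uv => vA.
    have : i.2.2 \in [set i.2.1; i.2.2] :&: A0 by rewrite !inE eqxx orbT.
    by rewrite (eqP tr) inE eq_sym.
  by rewrite iE uA uW ue (negbTE vA) vW ve.
have d0 : 0 < delta by rewrite invr_gt0 exprn_gt0 ?ltr0n.
have d1 : delta <= 1 by rewrite invf_le1 ?exprn_gt0 ?ltr0n // exprn_ege1 // ler1n.
have k2 : 1 <= 2 ^+ k :> R by rewrite exprn_ege1 // ler1n.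
(* Maximises [c * delta / 4 - 2 ^+ k * c ^+ 2], which bounds from below the net gain per heavy edge
   in units of [w]; the 4 is the loss in choosing [A0]. *)
pose c : R := delta / (8%:R * 2 ^+ k).
have k20 : 0 < 8%:R * 2 ^+ k :> R by lra.
have c0 : 0 <= c by rewrite divr_ge0 // ltW.
have c1 : c <= 1 by rewrite ler_pdivrMr // mul1r; lra.
pose w : R := (#|W|)%:R^-1.
have w0 : 0 <= w by rewrite invr_ge0.
have wW : w * (#|W|)%:R <= 1.
  have [->|W0] := eqVneq (#|W|)%:R (0 : R); first by rewrite mulr0.
  by rewrite mulVf.
have BW : (#|B|)%:R <= (#|W|)%:R :> R by rewrite ler_nat subset_leq_card // subsetDl.
pose b (u : V) x : R := - (c * w) * \sum_(v in B) dip v x.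
have cw0 : 0 <= c * w by exact: mulr_ge0.
have bn u x : `|b u x| <= 1.
  rewrite normrM normrN [`|c * w|]ger0_norm //.
  have Z : `|\sum_(v in B) dip v x| <= (#|W|)%:R.
    apply: (le_trans _ BW); rewrite -sum1_card natr_sum; apply: le_trans (ler_norm_sum _ _ _) _.
    by apply: ler_sum => v _; exact: dipole_norm.
  apply: le_trans (ler_wpM2l cw0 Z) _; rewrite -mulrA.
  by rewrite mulr_ile1 // mulr_ge0.
have bA : {in A &, forall u v x, b u (flip v 0 x) = b u x}.
  move=> u v _ vA x; rewrite /b; congr (_ * _); apply: eq_bigr => y yB.
  rewrite /dip flip_neq //; apply: contraTneq yB => ->.
  by rewrite inE vA.
have avgb u : avg (fun x => b u x ^+ 2) <= c ^+ 2 * w.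
  rewrite (@eq_avg _ _ _ _ (fun x => (c * w) ^+ 2 * (\sum_(v in B) dip v x) ^+ 2)); last first.
    by move=> x; rewrite /b exprMn sqrrN.
  rewrite avgZ; apply: le_trans (ler_wpM2l (sqr_ge0 _) (le_trans (avg_sqr_dips B) BW)) _.
  by rewrite exprMn -mulrA ler_wpM2l ?sqr_ge0 // expr2 -mulrA ler_piMr.
have [x hx] := tilt E (fun u _ => bn u) bA.
exists x; apply: le_trans hx.
have one e : e \in E -> avg (rainbowR e) + c * w * delta * (N e)%:R
     - (1 < #|W :&: e|)%N%:R * (2 ^+ k * (c ^+ 2 * w))
   <= \sum_(U : {set V} | U \subset A :&: e)
      avg (fun x => (rainbow e x)%:R * \prod_(u in U) (dipole R 0 (x u) * b u x)).
  move=> eE; rewrite sum_subsets -!addrA lerD //.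
    by apply: ler_avg => y; rewrite big_set0 mulr1.
  apply: lerD.
    rewrite /N natr_sum mulr_sumr -(pair_big_dep (mem (A :&: e)) (fun _ v => v \in B) (fun u v
      => c * w * delta * (v \in e)%:R)) /=.
    apply: ler_sum => u uAe.
    rewrite (@eq_avg _ _ _ _ (fun y => \sum_(v in B) - (c * w) * (rainbowR e y * (dip u y * dip
      v y)))); last first.
      move=> y; rewrite big_set1 /b !mulrA mulr_sumr; apply: eq_bigr => v _.
      by rewrite /rainbowR /dip; ring.
    rewrite avg_sum; apply: ler_sum => v vB.
    have uv : u != v.
      by apply: contraTneq vB => <-; move: uAe; rewrite !inE => /andP[->].
    rewrite avgZ mulNr -mulrN -[leLHS]mulrA ler_wpM2l //.
    case ve: (v \in e); last by rewrite dip_pair0 ?ve // oppr0 mulr0.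
    by rewrite mulr1 pair_coefficient //; move: uAe; rewrite inE => /andP[].
  (* As [A] lies in [W], an edge with at most one vertex in [W] has no [U] of size above 1, so only
     heavy edges are charged an error. *)
  case: (ltnP 1 #|W :&: e|) => hWe; last first.
    rewrite mul0r oppr0 big1 // => U /andP[UAe U2].
    have := leq_trans (subset_leq_card UAe) (leq_trans (subset_leq_card _) hWe).
    by rewrite leqNgt U2 => /(_ (setSI _ (subsetIr _ _))).
  rewrite mul1r lerNl -sumrN.
  have cardU : (\sum_(U : {set V} | (U \subset A :&: e) && (1 < #|U|)) 1 <= 2 ^ k)%N.
    rewrite -(Ek eE) -card_powerset sum1dep_card; apply: subset_leq_card.
    apply/subsetP => U; rewrite !inE => /andP[+ _] => UAe.
    exact: subset_trans UAe (subsetIr _ _).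
  apply: (@le_trans _ _ (\sum_(U : {set V} | (U \subset A :&: e) && (1 < #|U|)%N) c ^+ 2 * w)).
    apply: ler_sum => U /andP[_ U2]; have [u uU] : exists u, u \in U.
      by apply/set0Pn; rewrite -card_gt0; apply: ltn_trans U2.
    apply: le_trans _ (avgb u); apply: le_trans (ler_norm _) _; rewrite normrN.
    apply: le_trans (ler_norm_avg _) _; apply: ler_avg => y.
    rewrite normrM; apply: le_trans (ler_piMl _ _) _; rewrite ?normr_ge0 //.
      by rewrite ger0_norm ?ler0n // lern1 leq_b1.
    (* [b] ignores its vertex argument and is at most 1 in absolute value, so the product over [U]
       is at most its square. *)
    rewrite normr_prod; apply: (@le_trans _ _ (\prod_(v in U) `|b u y|)).
      apply: ler_prod => v _; rewrite normr_ge0 normrM.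
      by rewrite ler_piMl ?normr_ge0 //; exact: dipole_norm.
    rewrite prodr_const -normrX -[leRHS]ger0_norm ?sqr_ge0 // !normrX.
    by rewrite ler_wiXn2l ?normr_ge0.
  rewrite (eq_bigr (fun=> 1%:R * (c ^+ 2 * w))) => [|U _]; last by rewrite mul1r.
  rewrite -mulr_suml -natr_sum; apply: ler_wpM2r; first by apply: mulr_ge0; rewrite ?sqr_ge0.
  by rewrite -natrX ler_nat.
apply: le_trans (ler_sum _ one).
rewrite sumrB big_split /= -addrA lerD2l -mulr_sumr -mulr_suml -!natr_sum.
have -> : (\sum_(e in E) (1 < #|W :&: e|)%N = #|[set e in E | (1 < #|W :&: e|)%N]|)%N.
  rewrite -sum1_card [LHS]big_mkcond [RHS]big_mkcond /=; apply: eq_bigr => e _.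
  by rewrite inE; case: (e \in E) => //=; case: (1 < _)%N.
set M := #|[set e in E | _]| in hN *; set S := (\sum_(e in E) N e)%N in hN *.
have hN' : M%:R <= 4 * S%:R :> R by rewrite -natrM ler_nat.
have -> : delta ^+ 2 / (64 * 2 ^+ k) * (M%:R / #|W|%:R)
   = c * w * delta * (M%:R / 4) - M%:R * (2 ^+ k * (c ^+ 2 * w)).
  by rewrite /c -/w; field; rewrite gt_eqF // (lt_le_trans ltr01).
rewrite lerD2r ler_wpM2l //; first by apply: mulr_ge0; rewrite // ltW.
lra.
Qed.
End HeavyVertices.

(** * Sparse families *)

Definition degree (V : finType) (E : {set {set V}}) (S : {set V}) : nat :=
  #|[set e in E | S \subset e]|.

Lemma subset_of_card (V : finType) (n : nat) (S : {set V}) : (n <= #|S|)%N ->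
  exists2 X : {set V}, X \subset S & #|X| = n.
Proof.
move=> nS; exists [set v in take n (enum S)].
  by apply/subsetP => v; rewrite inE => /mem_take; rewrite mem_enum.
rewrite cardsE; have /card_uniqP -> := take_uniq n (enum_uniq S).
by rewrite size_takel // -cardE.
Qed.

(** If every value is repeated there are at most [p] values, so [f] factors through ['I_p]; the
    bound counts pairs of factors. *)
Lemma card_paired (J : finType) (D : {set J}) (p : nat) : (0 < p)%N ->
  (#|[set f : {ffun 'I_(p.*2) -> J} | (f \in ffun_on D) &&
       [forall i, exists i', (i' != i) && (f i' == f i)]]|
    <= p ^ p.*2 * #|D| ^ p)%N.
Proof.
move=> p0; set S := [set f | _].
pose g (c : {ffun 'I_p -> J} * {ffun 'I_(p.*2) -> 'I_p}) := [ffun i => c.1 (c.2 i)].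
have -> : (p ^ p.*2 * #|D| ^ p)%N = #|setX [set c : {ffun 'I_p -> J} | c \in ffun_on D] [set:
  {ffun 'I_(p.*2) -> 'I_p}]|.
  rewrite cardsX cardsT card_ffun !card_ord mulnC; congr (_ * _)%N.
  by rewrite cardsE card_ffun_on card_ord.
apply: leq_trans (leq_imset_card g _); apply: subset_leq_card; apply/subsetP => f.
rewrite inE => /andP[/ffun_onP fD /forallP pair].
pose X := [set f i | i : 'I_(p.*2)].
have Xp : (#|X| <= p)%N.
  rewrite -leq_double -[leqRHS]card_ord -[leqRHS]sum1_card.
  rewrite (partition_big f (mem X)) /=; last by move=> i _; apply: imset_f.
  rewrite -muln2 -sum_nat_const; apply: leq_sum => j /imsetP[i _ ->].
  have /existsP[i' /andP[ii' /eqP fi]] := pair i.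
  by rewrite (bigD1 i) //= (bigD1 i') /= ?fi ?eqxx ?ii'.
have i0 : 'I_(p.*2) by apply: (@Ordinal _ 0); rewrite double_gt0.
apply/imsetP; exists ([ffun i : 'I_p => nth (f i0) (enum X) i],
   [ffun i => odflt (Ordinal p0) (insub (index (f i) (enum X)))]).
  rewrite !inE andbT; apply/ffun_onP => i; rewrite ffunE.
  have [iX|iX] := ltnP i (size (enum X)); last by rewrite nth_default.
  by have := mem_nth (f i0) iX; rewrite mem_enum => /imsetP[i' _ ->].
apply/ffunP => i; rewrite !ffunE /= insubT /=.
  by apply: leq_trans Xp; rewrite cardE index_mem mem_enum imset_f.
by move=> ?; rewrite nth_index // mem_enum imset_f.
Qed.

Section Truncation.
Variable R : realType.

(** The products differ only if some [z v] exceeds 1 in absolute value. Then the truncated one is 0,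
    and the other is at most the largest absolute value to the power [#|U|], hence to the power
    [p.*2]. *)
Lemma truncation_error (V : finType) (U : {set V}) (p : nat) (a : R) (d z : V -> R) :
    `|a| <= 1 -> (forall v, `|d v| <= 1) -> (#|U| <= p.*2)%N ->
  `| a * \prod_(v in U) (d v * (if `|z v| <= 1 then z v else 0))
     - a * \prod_(v in U) (d v * z v) | <= \sum_(v in U) z v ^+ p.*2.
Proof.
move=> a1 d1 Up.
have pos v : 0 <= z v ^+ p.*2 by rewrite -mul2n exprM exprn_ge0 // sqr_ge0.
have [/forall_inP small|] := boolP [forall v in U, `|z v| <= 1].
  rewrite (eq_bigr (fun v => d v * z v)) => [|v vU]; last by rewrite small.
  by rewrite subrr normr0 sumr_ge0.
rewrite negb_forall_in => /exists_inP[w wU zw].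
have [m mU mmax] := @Order.TotalTheory.arg_maxP _ _ _ w (mem U) (fun v => `|z v|) wU.
have z1 : 1 <= `|z m|.
  by apply: le_trans (mmax w wU); apply: ltW; rewrite ltNge.
rewrite [X in a * X - _](bigD1 w) //= (negbTE zw) mulr0 mul0r mulr0 sub0r normrN.
apply: (@le_trans _ _ (z m ^+ p.*2)); last first.
  by rewrite (bigD1 m) //= lerDl sumr_ge0.
rewrite normrM; apply: le_trans (ler_piMl _ a1) _; rewrite ?normr_ge0 // normr_prod.
apply: (@le_trans _ _ (\prod_(v in U) `|z m|)).
  apply: ler_prod => v vU; rewrite normr_ge0 normrM /=.
  by apply: le_trans (ler_piMl _ (d1 v)) _; rewrite ?normr_ge0 //; apply: mmax.
rewrite prodr_const -[leRHS]ger0_norm // normrX.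
by rewrite ler_weXn2l.
Qed.

End Truncation.

(** * Gain from tilting along a sparse family *)

Section SparseFamily.
Variables (R : realType) (V : finType) (r k q p h rho N : nat).
Variables (E F : {set {set V}}) (A : {set V}) (u : {set V} -> V) (eta : R).
Hypotheses (Ek : uniform k E) (rk : (r.+1 <= k)%N) (kr : (k <= r.+1 + q)%N).
Hypotheses (qp : (q.+2 <= p.*2)%N) (h0 : (0 < h)%N) (hr : (h.*2 <= r.+1)%N).
Hypotheses (rho0 : (0 < rho)%N) (rhoh : (p.*2 * rho <= h.*2)%N).
Hypothesis (Fcard : {in F, forall T : {set V}, #|T| = h.*2}).
Hypothesis (Ftrace : {in F, forall T : {set V}, T :&: A = [set u T]}).
Hypothesis (Fsparse : {in F &, forall T T' : {set V}, T != T' -> (#|T :&: T'| < rho)%N}).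
Hypothesis (FN : forall v, (#|[set T in F | u T == v]| <= N)%N).
Hypotheses (eta0 : 0 < eta) (eta1 : eta * 2 ^+ k <= 1).

Notation col := {ffun V -> 'I_r.+1}.
Let rainbowR (e : {set V}) (x : col) : R := (rainbow e x)%:R.
Let dip (v : V) (x : col) : R := dipole R 0 (x v).
Let delta : R := r.+1%:R ^- k.

(** [u T] comes first so that it is assigned dipole 0, the one that [tilt] supplies; [chi T] holds
    the other factors. *)
Let order (T : {set V}) : seq V := u T :: enum (T :\ u T).
Let chi (T : {set V}) (x : col) : R :=
  \prod_(v in T :\ u T) dipole R (index v (order T))./2 (x v).
Let fam v : {set {set V}} := [set T in F | u T == v].
Let y v x := \sum_(T in fam v) chi T x.
(** The sign cancels the one in [top_coefficient_seq]. *)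
Let z v x := (-1) ^+ h * eta * y v x.
Let b v x := if `|z v x| <= 1 then z v x else 0.

Let uT T : T \in F -> u T \in T.
Proof.
move=> TF; have : u T \in [set u T] by rewrite inE.
by rewrite -Ftrace // inE => /andP[].
Qed.

Let uA T : T \in F -> u T \in A.
Proof.
move=> TF; have : u T \in [set u T] by rewrite inE.
by rewrite -Ftrace // inE => /andP[].
Qed.

Let notA T v : T \in F -> v \in T :\ u T -> v \notin A.
Proof.
move=> TF; rewrite !inE => /andP[vu vT]; apply: contra vu => vA.
by rewrite -in_set1 -Ftrace // inE vT.
Qed.

Let chi_flip T v j x : v \notin T :\ u T -> chi T (flip v j x) = chi T x.
Proof.
move=> vT; apply: eq_bigr => w wT; rewrite flip_neq //.
by apply: contraNneq vT => <-.
Qed.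

Let chi_norm T x : `|chi T x| <= 1.
Proof.
by rewrite /chi normr_prod prodr_ile1 // => v _; rewrite normr_ge0 dipole_norm.
Qed.

(* A factor [chi (tau i0)] averages out as soon as [tau i0] has a vertex that
   nothing else in the product looks at. *)
Let chi_vanish (I : finType) (P : pred I) (tau : I -> {set V}) (G : col -> R)
    (i0 : I) (v : V) : P i0 -> v \in tau i0 :\ u (tau i0) ->
    (forall i, P i -> i != i0 -> v \notin tau i) ->
    (forall j x, G (flip v j x) = G x) ->
  avg (fun x => G x * \prod_(i | P i) chi (tau i) x) = 0.
Proof.
move=> Pi0 vt vo Gv; apply: (@avg_odd _ _ _ v (index v (order (tau i0)))./2) => x.
rewrite Gv -mulrN (bigD1 i0) //= [in RHS](bigD1 i0) //= -mulNr; congr (_ * (_ * _)).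
  rewrite /chi (bigD1 v) //= [in RHS](bigD1 v) //= dipole_flip mulNr.
  congr (- (_ * _)); apply: eq_bigr => w /andP[_ wv].
  by rewrite flip_neq.
apply: eq_bigr => i /andP[Pi ii0]; apply: chi_flip.
by rewrite !inE negb_and (vo i Pi ii0) orbT.
Qed.

(** [T] has at least [p.*2 * rho] vertices; [D] takes at most [rho] of them and each of the fewer
    than [p.*2] other members at most [rho - 1]. *)
Let exists_private (I : finType) (P : pred I) (tau : I -> {set V}) (T : {set V})
    (D : {set V}) : T \in F -> (#|T :&: D| <= rho)%N -> (#|[set i | P i]| < p.*2)%N ->
    (forall i, P i -> tau i \in F /\ tau i != T) ->
  exists v, [/\ v \in T, v \notin D & forall i, P i -> v \notin tau i].
Proof.
move=> TF TD cP tauP.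
have [v /andP[vT /andP[vD /forallP vtau]]|none] := @pickP _ [pred v in T | (v \notin D) &&
  [forall i, P i ==> (v \notin tau i)]].
  by exists v; split=> // i Pi; apply: (implyP (vtau i)).
suff : (#|T| < h.*2)%N by rewrite Fcard // ltnn.
apply: leq_trans rhoh; rewrite -sum1_card.
apply: (@leq_ltn_trans (\sum_(v in T) ((v \in D) + \sum_(i | P i) (v \in tau i)))%N).
  apply: leq_sum => v vT; have := none v; rewrite /= vT /=.
  case: (v \in D) => //= /negbT; rewrite negb_forall => /existsP[i].
  by rewrite negb_imply negbK => /andP[Pi vi]; rewrite (bigD1 i) //= vi.
rewrite big_split exchange_big /=.
have cap (S : {set V}) : (\sum_(v in T) (v \in S) = #|T :&: S|)%N.
  rewrite -sum1_card big_mkcond [RHS]big_mkcond /=; apply: eq_bigr => v _.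
  by rewrite inE; case: (v \in T); case: (v \in S).
rewrite cap; apply: (@leq_ltn_trans (rho + \sum_(i | P i) rho.-1)%N).
  apply: leq_add => //; apply: leq_sum => i Pi; rewrite cap.
  have [tF tT] := tauP i Pi; have := Fsparse TF tF; rewrite eq_sym => /(_ tT).
  by case: rho rho0.
rewrite sum_nat_const; move: cP; rewrite cardsE.
by move: rho0; case: rho => // s _ /=; nia.
Qed.

(** Each [T \subset e] contributes through [top_coefficient_seq]; any other [T] has a vertex outside
    [e] that no other factor looks at, and contributes 0. *)
Lemma single_term (e : {set V}) (v : V) : e \in E -> v \in A :&: e ->
  eta * delta * (#|[set T in fam v | T \subset e]|)%:R <=
    avg (fun x => rainbowR e x * (dip v x * z v x)).
Proof.
move=> eE; rewrite inE => /andP[vA ve].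
have term T : T \in fam v -> eta * delta * (T \subset e)%:R <=
    avg (fun x => (-1) ^+ h * eta * (rainbowR e x * dip v x * chi T x)).
  rewrite inE => /andP[TF /eqP uTv]; rewrite avgZ [(-1) ^+ h * eta]mulrC -!mulrA.
  rewrite ler_wpM2l ?(ltW eta0) //.
  have [Te|/subsetPn[w wT we]] := boolP (T \subset e).
    rewrite mulr1 /delta -(Ek eE).
    have uo : uniq (order T) by rewrite /= mem_enum !inE eqxx enum_uniq.
    have so : size (order T) = h.*2.
      by rewrite /= -cardE -(Fcard TF) (cardsD1 (u T) T) uT.
    have oe : {subset order T <= e}.
      move=> w; rewrite inE mem_enum => /predU1P[->|]; first by rewrite uTv.
      by rewrite inE => /andP[_ /(subsetP Te)].
    have re : (r.+1 <= #|e|)%N by rewrite (Ek eE).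
    apply: le_trans (top_coefficient_seq R uo so oe h0 hr re) _.
    rewrite le_eqVlt; apply/orP; left; apply/eqP; congr (_ * _); apply: eq_avg => x.
    by rewrite /chi /order big_cons big_enum /= eqxx uTv -mulrA.
  rewrite mulr0 (@eq_avg _ _ _ _ (fun x => (rainbowR e x * dip v x) * \prod_(i < 1) chi T x)).
    rewrite (chi_vanish (i0 := ord0) (v := w)) ?mulr0 //.
    - by rewrite !inE uTv wT andbT; apply: contraNneq we => ->.
    - by move=> i _; rewrite (ord1 i) eqxx.
    - move=> j x; rewrite /rainbowR /dip rainbow_flip // flip_neq //.
      by apply: contraNneq we => <-.
  by move=> x; rewrite big_ord1.
rewrite -sum1dep_card natr_sum mulr_sumr.
rewrite (@eq_avg _ _ _ _ (fun x => \sum_(T in fam v) (-1) ^+ h * eta * (rainbowR e x * dip v x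
  * chi T x))); last first.
  by move=> x; rewrite /z /y !mulr_sumr; apply: eq_bigr => T _; ring.
rewrite avg_sum big_mkcondr; apply: ler_sum => T Tv; apply: le_trans (term T Tv).
by case: (T \subset e); rewrite ?mulr0.
Qed.

(** Expand into choices of [f v] in [fam v], distinct because [u (f v) = v]. Only choices inside
    [near] survive, at most [2 ^ k] for each [v], and [eta * 2 ^+ k <= 1] reduces the power [#|U|]
    to 2. *)
Lemma multi_term (e U : {set V}) : e \in E -> U \subset A :&: e -> (1 < #|U|)%N -> (#|U| <=
  p.*2)%N ->
  - (4 ^+ k * eta ^+ 2) <=
    avg (fun x => rainbowR e x * \prod_(v in U) (dip v x * z v x)).
Proof.
move=> eE UAe U2 Up.
have UA v : v \in U -> v \in A by move/(subsetP UAe); rewrite inE => /andP[].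
have Ue v : v \in U -> v \in e by move/(subsetP UAe); rewrite inE => /andP[].
pose Q v := [pred T | T \in fam v].
pose G x := rainbowR e x * \prod_(v in U) dip v x.
have G1 x : `|G x| <= 1.
  rewrite normrM mulr_ile1 ?normr_ge0 //.
    by rewrite ger0_norm ?ler0n // lern1 leq_b1.
  by rewrite normr_prod prodr_ile1 // => v _; rewrite normr_ge0 dipole_norm.
have expand x : rainbowR e x * \prod_(v in U) (dip v x * z v x)
   = ((-1) ^+ h * eta) ^+ #|U| *
     \sum_(f in pfamily set0 (mem U) Q) G x * \prod_(v in U) chi (f v) x.
  rewrite big_split /= mulrA -/(G x) big_split /= prodr_const mulrCA; congr (_ * _).
  rewrite -mulr_sumr; congr (_ * _).
  exact: (big_distr_big_dep set0 (mem U) Q (fun v T => chi T x)).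
pose near := [set T in F | (rho <= #|T :&: e|)%N].
(* By sparseness, a member meeting [e] in at least [rho] vertices is determined by its trace on
   [e]. *)
have nearle : (#|near| <= 2 ^ k)%N.
  rewrite -(Ek eE) -card_powerset -(@card_in_imset _ _ (fun T : {set V} => T :&: e) (mem near)).
    apply: subset_leq_card; apply/subsetP => X /imsetP[T _ ->].
    by rewrite inE subsetIr.
  move=> T T'; rewrite !inE => /andP[TF Te] /andP[TF' _] TT'.
  apply/eqP; apply: contraTT Te => nTT'; rewrite -ltnNge.
  apply: leq_ltn_trans (Fsparse TF TF' nTT'); apply: subset_leq_card.
  by rewrite subsetI subsetIl TT' subsetIl.
(* A chosen member outside [near] keeps a private vertex outside [e]. *)
have far f : f \in pfamily set0 (mem U) Q -> ~~ (f \in pffun_on set0 (mem U) (mem near)) ->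
    avg (fun x => G x * \prod_(v in U) chi (f v) x) = 0.
  move=> /pfamilyP[fU fQ] nf.
  have [v0 v0U v0far] : exists2 v0, v0 \in U & f v0 \notin near.
    apply/exists_inP; apply: contraR nf; rewrite negb_exists_in => /forall_inP nf.
    by apply/pffun_onP; split=> // T /imageP[v vU ->]; apply/negPn; apply: nf.
  have fF v : v \in U -> f v \in F /\ u (f v) = v.
    by move=> vU; have := fQ v vU; rewrite !inE => /andP[-> /eqP].
  have [TF uTv] := fF _ v0U.
  have Tfar : (#|f v0 :&: e| <= rho)%N.
    by move: v0far; rewrite inE TF /= -ltnNge => /ltnW.
  have [||w [wT we wo]] := @exists_private V [pred v in U | v != v0] f (f v0) e TF Tfar.
  - apply: leq_trans Up; rewrite (cardsD1 v0 U) v0U add1n ltnS.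
    by apply: subset_leq_card; apply/subsetP => v; rewrite !inE andbC.
  - move=> v /andP[vU vv0]; have [vF uv] := fF v vU; split=> //.
    by apply: contra vv0 => /eqP fv; rewrite -uv fv uTv.
  apply: (chi_vanish (i0 := v0) (v := w)) => //.
  - by rewrite !inE uTv wT andbT; apply: contraNneq we => ->; apply: Ue.
  - by move=> v vU vv0; apply: wo; rewrite /= vU.
  - move=> j x; rewrite /G /rainbowR rainbow_flip //; congr (_ * _).
    apply: eq_bigr => v vU; rewrite /dip flip_neq //.
    by apply: contraNneq we => <-; apply: Ue.
rewrite (eq_avg expand) avgZ avg_sum.
rewrite -[X in _ <= X]opprK lerN2; apply: le_trans (ler_norm _) _; rewrite normrN.
rewrite normrM normrX normrM normrX normrN1 expr1n mul1r gtr0_norm //.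
have sumle : `|\sum_(f in pfamily set0 (mem U) Q) avg (fun x => G x * \prod_(v in U) chi (f v) x)|
    <= (2 ^+ k) ^+ #|U|.
  apply: le_trans (ler_norm_sum _ _ _) _.
  apply: (@le_trans _ _ (\sum_(f in pffun_on set0 (mem U) (mem near)) (1 : R))).
    rewrite big_mkcond [leRHS]big_mkcond; apply: ler_sum => f _.
    case: ifP => [fp|_]; last by case: ifP.
    case: ifP => [_|/negbT fn]; last by rewrite far ?normr0.
    apply: le_trans (ler_norm_avg _) _; rewrite -[leRHS](@avg_cst R V r).
    apply: ler_avg => x; rewrite normrM mulr_ile1 ?normr_ge0 //.
    by rewrite normr_prod prodr_ile1 // => v _; rewrite normr_ge0 chi_norm.
  rewrite sumr_const card_pffun_on -!natrX ler_nat.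
  by rewrite leq_exp2r; [exact: nearle | exact: ltnW].
apply: le_trans (ler_wpM2l _ sumle) _; first by rewrite exprn_ge0 // ltW.
rewrite -exprMn; have e0 : 0 <= eta * 2 ^+ k by rewrite mulr_ge0 ?exprn_ge0 // ltW.
apply: le_trans (ler_wiXn2l e0 eta1 U2) _.
rewrite exprMn -exprM mulnC exprM mulrC le_eqVlt; apply/orP; left; apply/eqP.
by congr (_ ^+ k * _); rewrite expr2 -natrM.
Qed.

(** In the expanded power, a member occurring once has a private vertex and averages out, leaving
    the choices counted by [card_paired]. *)
Lemma moment v : avg (fun x => y v x ^+ p.*2) <= (p ^ p.*2 * N ^ p)%:R.
Proof.
have p0 : (0 < p)%N by lia.
have expand x : y v x ^+ p.*2 =
    \sum_(f in ffun_on (mem (fam v))) 1 * \prod_(i < p.*2) chi (f i) x.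
  rewrite -[X in _ ^+ X]card_ord -prodr_const (bigA_distr_big (mem (fam v)) (fun _ T => chi T x)).
  by apply: eq_bigr => f _; rewrite mul1r.
rewrite (eq_avg expand) avg_sum.
have vanish f : f \in ffun_on (mem (fam v)) ->
    ~~ [forall i, exists i', (i' != i) && (f i' == f i)] ->
    avg (fun x => 1 * \prod_(i < p.*2) chi (f i) x) = 0.
  move=> /ffun_onP fD; rewrite negb_forall => /existsP[i0].
  rewrite negb_exists => /forallP single.
  have fF i : f i \in F by have := fD i; rewrite inE => /andP[].
  (* The private vertex must also differ from [u (f i0)], at which [chi (f i0)] does not look. *)
  have [|||w [wT wu wo]] := @exists_private _ [pred i | i != i0] f (f i0) [set u (f i0)] (fF i0).
  - by apply: leq_trans (subset_leq_card (subsetIr _ _)) _; rewrite cards1.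
  - rewrite (_ : [set i | _] = [set~ i0]); last by apply/setP => i; rewrite !inE.
    by rewrite cardsC1 card_ord; lia.
  - by move=> i /= ii0; split=> //; have := single i; rewrite ii0.
  apply: (chi_vanish (i0 := i0) (v := w)) => //.
  - by move: wu; rewrite !inE wT => ->.
  - by move=> i _; apply: wo.
apply: (@le_trans _ _ (\sum_(f in [set f : {ffun 'I_(p.*2) -> {set V}} | (f \in ffun_on (mem
  (fam v))) &&
       [forall i, exists i', (i' != i) && (f i' == f i)]]) (1 : R))).
  rewrite big_mkcond [leRHS]big_mkcond; apply: ler_sum => f _; rewrite inE.
  case: ifP => fD //=; case: ifP => [_|/negbT fn]; last by rewrite vanish.
  rewrite -[leRHS](@avg_cst R V r); apply: ler_avg => x; rewrite mul1r.
  apply: le_trans (ler_norm _) _.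
  by rewrite normr_prod prodr_ile1 // => i _; rewrite normr_ge0 chi_norm.
rewrite sumr_const ler_nat; apply: leq_trans (card_paired _ p0) _.
by rewrite leq_mul2l leq_exp2r // FN orbT.
Qed.

Let M : R := eta ^+ p.*2 * (p ^ p.*2 * N ^ p)%:R.

(** If no dipole on [U] vanishes, [U] carries only the two poles, and the other colours must all
    appear on [e :\: U]. That set is too small since [k <= r.+1 + q] and [q.+2 <= p.*2]. *)
Lemma large_term (e U : {set V}) (x : col) : e \in E -> U \subset e -> (p.*2 < #|U|)%N ->
  rainbowR e x * \prod_(v in U) dip v x = 0.
Proof.
move=> eE Ue Up; have [/existsP[v /andP[vU /eqP dv]]|] := boolP [exists v, (v \in U) && (dip v
  x == 0)].
  by rewrite (bigD1 v) //= dv mul0r mulr0.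
rewrite negb_exists => /forallP nz; rewrite /rainbowR.
case re: (rainbow e x); last by rewrite mul0r.
suff : (r.+1 - 2 <= #|e :\: U|)%N.
  by rewrite cardsD (setIidPr Ue) (Ek eE); move: rk kr qp Up (subset_leq_card Ue); rewrite (Ek
    eE); lia.
have -> : (r.+1 - 2 = #|~: [set pole0 r 0; pole1 r 0]|)%N.
  rewrite cardsCs setCK card_ord cards2.
  by rewrite -val_eqE /= !inordK; lia.
apply: leq_trans (leq_imset_card (fun v => x v) _); apply: subset_leq_card.
apply/subsetP => c; rewrite !inE negb_or => /andP[c0 c1].
have [v ve xv] := rainbowP _ _ re c; apply/imsetP; exists v => //.
rewrite inE ve andbT; have := nz v; rewrite negb_and => /orP[//|].
by rewrite /dip /dipole xv (negbTE c0) (negbTE c1) subrr eqxx.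
Qed.

Lemma sparse_gain : exists x : col,
  \sum_(e in E) avg (rainbowR e) + eta * delta * (\sum_(T in F) degree E T)%:R
   - (#|E|)%:R * (2 ^+ k * (k%:R * M + 4 ^+ k * eta ^+ 2))
  <= (#|[set e in E | rainbow e x]|)%:R.
Proof.
have b1 v x : `|b v x| <= 1 by rewrite /b; case: ifP; rewrite ?normr0.
have bA : {in A &, forall v w x, b v (flip w 0 x) = b v x}.
  move=> v w _ wA x; suff zz : z v (flip w 0 x) = z v x by rewrite /b zz.
  rewrite /z; congr (_ * _); apply: eq_bigr => T; rewrite inE => /andP[TF _].
  by apply: chi_flip; apply: contraL wA; apply: notA.
have [x hx] := tilt E (fun v _ => b1 v) bA.
exists x; apply: le_trans hx.
have M0 : 0 <= M by rewrite mulr_ge0 // exprn_ge0 // ltW.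
have zM v : avg (fun x => z v x ^+ p.*2) <= M.
  rewrite (@eq_avg _ _ _ _ (fun x => eta ^+ p.*2 * y v x ^+ p.*2)); last first.
    by move=> w; rewrite /z !exprMn -exprM -signr_odd oddM odd_double andbF mul1r.
  by rewrite avgZ ler_wpM2l ?moment // exprn_ge0 // ltW.
(* Passing from [z] to the truncated [b] costs at most [k%:R * M]; the sets [U] too large for this
   are handled by [large_term]. *)
have trunc (e U : {set V}) : e \in E -> U \subset A :&: e ->
    avg (fun x => rainbowR e x * \prod_(v in U) (dip v x * z v x)) - k%:R * M
    <= avg (fun x => rainbowR e x * \prod_(v in U) (dip v x * b v x)) \/ (p.*2 < #|U|)%N.
  move=> eE UAe; have [Up|Up] := leqP #|U| p.*2; [left|by right].
  rewrite lerBlDr -lerBlDl -avgB; apply: le_trans (ler_norm _) _.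
  apply: le_trans (ler_norm_avg _) _.
  apply: (@le_trans _ _ (avg (fun x => \sum_(v in U) z v x ^+ p.*2))).
    apply: ler_avg => w; rewrite distrC; apply: truncation_error => //.
      by rewrite /rainbowR ger0_norm ?ler0n // lern1 leq_b1.
    by move=> v; apply: dipole_norm.
  rewrite avg_sum; apply: le_trans (ler_sum _ (fun v _ => zM v)) _.
  rewrite sumr_const -[M *+ _]mulr_natl ler_wpM2r // ler_nat -(Ek eE).
  by apply: subset_leq_card; apply: subset_trans UAe (subsetIr _ _).
have cardU e : e \in E -> (#|[set U : {set V} | U \subset A :&: e]| <= 2 ^ k)%N.
  move=> eE; rewrite -(Ek eE) -card_powerset; apply: subset_leq_card.
  by apply/subsetP => U; rewrite !inE => UAe; apply: subset_trans UAe (subsetIr _ _).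
pose err : R := k%:R * M + 4 ^+ k * eta ^+ 2.
have err0 : 0 <= err by rewrite addr_ge0 ?mulr_ge0 ?exprn_ge0 // ltW.
pose G (e U : {set V}) := avg (fun x => rainbowR e x * \prod_(v in U) (dip v x * b v x)).
have G1 (e : {set V}) (v : V) : e \in E -> v \in A :&: e ->
    eta * delta * (#|[set T in fam v | T \subset e]|)%:R - err <= G e [set v].
  move=> eE vAe; have vsub : [set v] \subset A :&: e by rewrite sub1set.
  have [|] := trunc e _ eE vsub; last by rewrite cards1; lia.
  have e2 : 0 <= 4 ^+ k * eta ^+ 2 by rewrite mulr_ge0 // exprn_ge0 // ltW.
  have h1 := single_term eE vAe.
  rewrite (@eq_avg _ _ _ _ (fun x => rainbowR e x * (dip v x * z v x))).
    by rewrite -/(G e [set v]) /err => h2; lra.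
  by move=> w; rewrite big_set1.
have G2 (e U : {set V}) : e \in E -> (U \subset A :&: e) && (1 < #|U|)%N -> - err <= G e U.
  move=> eE /andP[UAe U2]; have [Up|Up] := leqP #|U| p.*2.
    have [h1|] := trunc e U eE UAe; last by rewrite ltnNge Up.
    apply: le_trans h1; rewrite /err opprD addrC lerD2r.
    exact: multi_term.
  rewrite /G (@eq_avg _ _ _ _ (fun=> 0)) ?avg0 ?oppr_le0 // => w.
  rewrite big_split mulrA large_term ?mul0r //.
  exact: subset_trans UAe (subsetIr _ _).
have one e : e \in E ->
    avg (rainbowR e) + eta * delta * (#|[set T in F | T \subset e]|)%:R - 2 ^+ k * err
    <= \sum_(U : {set V} | U \subset A :&: e) G e U.
  move=> eE; rewrite sum_subsets.
  have G0 : avg (rainbowR e) <= G e set0.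
    by apply: ler_avg => w; rewrite big_set0 mulr1.
  have GS1 : \sum_(v in A :&: e) (eta * delta * (#|[set T in fam v | T \subset e]|)%:R - err)
      <= \sum_(v in A :&: e) G e [set v].
    by apply: ler_sum => v; apply: G1.
  have GS2 : \sum_(U : {set V} | (U \subset A :&: e) && (1 < #|U|)%N) - err
      <= \sum_(U : {set V} | (U \subset A :&: e) && (1 < #|U|)%N) G e U.
    by apply: ler_sum => U; apply: G2.
  have cE : \sum_(U : {set V} | U \subset A :&: e) err <= 2 ^+ k * err.
    rewrite (eq_bigr (fun=> 1%:R * err)) => [|U _]; last by rewrite mul1r.
    rewrite -mulr_suml -natr_sum ler_wpM2r // -natrX ler_nat.
    by rewrite sum1dep_card cardU.
  have famE : (\sum_(v in A :&: e) #|[set T in fam v | T \subset e]|)%N = #|[set T in F | T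
    \subset e]|.
    rewrite -[RHS]sum1_card (partition_big u (mem (A :&: e))) /=; last first.
      by move=> T; rewrite !inE => /andP[TF /subsetP Te]; rewrite uA // Te // uT.
    apply: eq_bigr => v _; rewrite sum1dep_card; apply: eq_card => T.
    by rewrite !inE andbAC.
  move: cE GS1 GS2; rewrite sum_subsets sumrN sumrB -mulr_sumr -natr_sum famE => cE GS1 GS2.
  lra.
apply: le_trans (ler_sum _ one).
rewrite sumrB big_split /= -mulr_sumr -natr_sum sumr_const.
rewrite le_eqVlt; apply/orP; left; apply/eqP; congr (_ + _ * _%:R - _); last by rewrite mulr_natl.
rewrite (eq_bigr (fun T : {set V} => \sum_(e in E) (T \subset e)))%N => [|T _]; last first.
  rewrite /degree -sum1_card big_mkcond [RHS]big_mkcond; apply: eq_bigr => e _.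
  by rewrite inE; case: (e \in E); case: (T \subset e).
rewrite exchange_big; apply: eq_bigr => e _.
rewrite -sum1_card [RHS]big_mkcond [LHS]big_mkcond; apply: eq_bigr => T _.
by rewrite inE; case: (T \in F); case: (T \subset e).
Qed.
End SparseFamily.

(** Here [g j e] falls from at most [b ^+ L] at [j = 0] to at least 1 at [j = L], so some step loses
    at most a factor [b]; the most frequent such [j] is used. The factor [2 ^+ k] counts the subsets
    of a member. *)
Lemma sparse_family (R : realType) (V : finType) (k L Q : nat) (E E1 : {set {set V}}) (b : R) :
    uniform k E -> E1 \subset E -> 1 <= b -> (#|E|)%:R <= b ^+ L -> (0 < L)%N ->
    (0 < Q)%N -> (Q ^ L <= k)%N ->
  exists j : nat, exists F : {set {set V}}, [/\ (j < L)%N,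
    {in F, forall T : {set V}, #|T| = (Q ^ j.+1)%N},
    {in F, forall T : {set V}, exists2 e, e \in E1 & T \subset e},
    {in F &, forall T T' : {set V}, T != T' -> (#|T :&: T'| < Q ^ j)%N} &
    (#|E1|)%:R <= L%:R * 2 ^+ k * b * (\sum_(T in F) degree E T)%:R].
Proof.
move=> Ek /subsetP E1E b1 EbL L0 Q0 QL.
pose g j (e : {set V}) := \max_(T : {set V} | (T \subset e) && (#|T| == Q ^ j)%N) degree E T.
have g_ge j (e T : {set V}) : T \subset e -> #|T| = (Q ^ j)%N -> (degree E T <= g j e)%N.
  by move=> Te Tj; apply: leq_bigmax_cond; rewrite Te Tj eqxx.
have QLk j : (j <= L)%N -> (Q ^ j <= k)%N.
  by move=> jL; apply: leq_trans QL; rewrite leq_pexp2l.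
have g_att j (e : {set V}) : e \in E -> (j <= L)%N ->
    exists T : {set V}, [/\ T \subset e, #|T| = (Q ^ j)%N & degree E T = g j e].
  move=> eE jL; have [X Xe Xj] : exists2 X : {set V}, X \subset e & #|X| = (Q ^ j)%N.
    by apply: subset_of_card; rewrite (Ek _ eE) QLk.
  have [|T /andP[Te /eqP Tj] gT] := @eq_bigmax_cond _ [pred T : {set V} | (T \subset e) &&
    (#|T| == Q ^ j)%N] (degree E).
    by apply/card_gt0P; exists X; rewrite inE Xe Xj eqxx.
  by exists T; split.
pose ok (j : 'I_L) (e : {set V}) := (g j e)%:R <= b * (g j.+1 e)%:R.
have okE e : e \in E1 -> exists j, ok j e.
  move=> eE1; have eE := E1E _ eE1.
  apply/existsP; apply: contraT; rewrite negb_exists => /forallP bad.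
  have step j : (j < L)%N -> b ^+ j.+1 * (g j.+1 e)%:R < (g 0%N e)%:R.
    elim: j => [|j IH] jL; have := bad (Ordinal jL); rewrite /ok /= -ltNge => lt.
      by rewrite expr1.
    apply: le_lt_trans (IH (ltnW jL)); rewrite exprSr -mulrA ler_wpM2l ?(ltW lt) //.
    by rewrite exprn_ge0 // (le_trans ler01).
  have := step L.-1; rewrite prednK // => /(_ (leqnn _)).
  have [T [Te Tj <-]] := g_att _ _ eE (leqnn L); have [T0 [_ _ <-]] := g_att _ _ eE (leq0n L).
  have h1 : (degree E T0)%:R <= b ^+ L.
    apply: le_trans EbL; rewrite ler_nat; apply: subset_leq_card.
    by apply/subsetP => e'; rewrite inE => /andP[].
  have h2 : 1 <= (degree E T)%:R :> R.
    by rewrite ler1n; apply/card_gt0P; exists e; rewrite inE eE.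
  move/lt_le_trans/(_ h1); rewrite ltNge => /negP[].
  by rewrite ler_peMr // exprn_ge0 // (le_trans ler01).
have [j hj] : exists j : 'I_L, (#|E1| <= L * #|[set e in E1 | ok j e]|)%N.
  have [j _ jmax] := @arg_maxnP _ (Ordinal L0) predT (fun j => #|[set e in E1 | ok j e]|) isT.
  exists j; apply: (@leq_trans (\sum_(i < L) #|[set e in E1 | ok i e]|)).
    rewrite -sum1_card (eq_bigr (fun i : 'I_L => \sum_(e in E1) (ok i e)))%N; last first.
      move=> i _; rewrite -sum1_card big_mkcond [RHS]big_mkcond; apply: eq_bigr => e _.
      by rewrite inE; case: (e \in E1); case: (ok i e).
    rewrite exchange_big; apply: leq_sum => e /okE[i oki].
    by rewrite (bigD1 i) //= oki.
  by rewrite -[X in (_ <= X * _)%N]card_ord -sum_nat_const; apply: leq_sum => i _; apply: jmax.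
set E' := [set e in E1 | ok j e] in hj.
have E'P e : e \in E' -> [/\ e \in E1, e \in E & (g j e)%:R <= b * (g j.+1 e)%:R].
  by rewrite inE => /andP[eE1 ?]; split=> //; apply: E1E.
pose F0 := [set T : {set V} | (#|T| == Q ^ j.+1)%N && [exists e in E', (T \subset e) && (degree
  E T == g j.+1 e)]].
have F0P T : T \in F0 -> #|T| = (Q ^ j.+1)%N /\
    exists e, [/\ e \in E', T \subset e & degree E T = g j.+1 e].
  by rewrite inE => /andP[/eqP Tj /exists_inP[e eE' /andP[Te /eqP dT]]]; split=> //; exists e.
pose sparse (X : {set {set V}}) := (X \subset F0) &&
  [forall T in X, forall T' in X, (T != T') ==> (#|T :&: T'| < Q ^ j)%N].
have [F /maxsetP[/andP[/subsetP FF0 /forall_inP Fsp] Fmax] _] : {F | maxset sparse F & set0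
  \subset F}.
  apply: maxset_exists; rewrite /sparse sub0set; apply/forall_inP => T; by rewrite inE.
exists j, F; split => //.
- by move=> T /FF0/F0P[].
- by move=> T /FF0/F0P[_ [e [/E'P[eE1 _ _] Te _]]]; exists e.
- by move=> T T' TF T'F nTT'; have /forall_inP/(_ _ T'F) := Fsp _ TF; rewrite nTT'.
(* A set of [F0] meeting every member of [F] in fewer than [Q ^ j] vertices is not in [F] and could
   be added to it. *)
have meet T : T \in F0 -> exists2 T', T' \in F & (Q ^ j <= #|T :&: T'|)%N.
  move=> TF0; apply/exists_inP; apply: contraT; rewrite negb_exists_in => /forall_inP far.
  have TF : T \notin F.
    apply/negP => TF; have := far _ TF; rewrite setIid (F0P _ TF0).1.
    by rewrite leq_pexp2l.
  suff : T |: F = F by move=> TFF; rewrite -TFF setU11 in TF.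
  apply: Fmax; last exact: subsetUr.
  rewrite /sparse subUset sub1set TF0; apply/andP; split; first by apply/subsetP.
  apply/forall_inP => T1; rewrite !inE => /orP[/eqP->|T1F]; apply/forall_inP => T2; rewrite
    !inE => /orP[/eqP->|T2F].
  - by rewrite eqxx.
  - by rewrite ltnNge far // implybT.
  - by rewrite setIC ltnNge far // implybT.
  - by have /forall_inP/(_ _ T2F) := Fsp _ T1F.
pose sub (T : {set V}) := [pred X : {set V} | (X \subset T) && (#|X| == Q ^ j)%N].
(* Each edge of [E'] contains a member of [F0], which by maximality of [F] shares
   [Q ^ j] vertices with a member of [F]. *)
have E'le : (#|E'| <= \sum_(T in F) \sum_(X | sub T X) degree E X)%N.
  have degE (X : {set V}) : (\sum_(e in E') (X \subset e) <= degree E X)%N.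
    rewrite -big_mkcondr sum1dep_card; apply: subset_leq_card; apply/subsetP => e.
    by rewrite inE => /andP[/E'P[_ eE _] Xe]; rewrite inE eE.
  apply: (@leq_trans (\sum_(T in F) \sum_(X | sub T X) \sum_(e in E') (X \subset e))); last first.
    by apply: leq_sum => T _; apply: leq_sum => X _.
  rewrite (eq_bigr (fun T : {set V} => \sum_(e in E') \sum_(X | sub T X) (X \subset e)))%N;
    last first.
    by move=> T _; rewrite exchange_big.
  rewrite exchange_big /= -sum1_card; apply: leq_sum => e eE'; have [eE1 eE _] := E'P e eE'.
  have [T [Te Tj dT]] := g_att j.+1 e eE (ltn_ord j).
  have TF0 : T \in F0 by rewrite inE Tj eqxx; apply/exists_inP; exists e; rewrite // Te dT eqxx.
  have [T' T'F cap] := meet T TF0; have [X XTT' Xj] := subset_of_card cap.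
  rewrite (bigD1 T') //= (bigD1 X) /=; last by rewrite Xj eqxx (subset_trans XTT' (subsetIr _ _)).
  by rewrite (subset_trans XTT' (subset_trans (subsetIl _ _) Te)).
have b0 : 0 <= b by apply: le_trans b1.
apply: (@le_trans _ _ (L%:R * (#|E'|)%:R)); first by rewrite -natrM ler_nat.
rewrite -!mulrA ler_wpM2l //; apply: (@le_trans _ _ (\sum_(T in F) \sum_(X | sub T X) degree E
  X)%N%:R).
  by rewrite ler_nat.
rewrite !natr_sum !mulr_sumr; apply: ler_sum => T TF; rewrite natr_sum.
have [Tj [e [eE' Te dT]]] := F0P _ (FF0 _ TF); have [_ eE ge] := E'P _ eE'.
(* [X] lies in the edge [e] witnessing [T \in F0], so its degree is at most [g j e], hence at most
   [b * g j.+1 e]. *)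
apply: (@le_trans _ _ (\sum_(X | sub T X) b * (degree E T)%:R)).
  apply: ler_sum => X /andP[XT /eqP Xj]; rewrite dT; apply: le_trans ge.
  by rewrite ler_nat; apply: g_ge => //; apply: subset_trans XT Te.
rewrite sumr_const -[_ *+ #|_|]mulr_natl ler_wpM2r ?mulr_ge0 // -natrX ler_nat.
apply: (@leq_trans #|powerset T|).
  by apply: subset_leq_card; apply/subsetP => X; rewrite !inE => /andP[].
by rewrite card_powerset leq_pexp2l // Tj QLk.
Qed.

(** * Assembling the bounds *)

(** [b ^+ (3 * l)] stands for the number of edges and [c / b ^+ l.+1] for the bias scale [eta]. [M1]
    treats the gain, [M2] the error of [multi_term], [M3] that of truncation. *)
Lemma gain_arithmetic (R : realFieldType) (k l p : nat) (b c delta K P N D : R) :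
    1 <= b -> 0 < c -> c <= 1 -> 0 < delta -> 0 < K -> 0 <= P -> 0 <= N ->
    N <= 2 ^+ k * b ^+ (2 * l) -> (0 < p)%N -> (l.+2 <= p.*2)%N ->
    b ^+ (3 * l) <= 2 * K * 4 ^+ k * b * D ->
  (c * (delta / (2 * K * 4 ^+ k)) - c ^+ 2 * (8 ^+ k + 2 ^+ k * k%:R * P * (2 ^+ k) ^+ p))
      * (b ^+ (2 * l) / b ^+ 2)
    <= c / b ^+ l.+1 * delta * D
       - b ^+ (3 * l) * (2 ^+ k * (k%:R * ((c / b ^+ l.+1) ^+ p.*2 * (P * N ^+ p))
                                   + 4 ^+ k * (c / b ^+ l.+1) ^+ 2)).
Proof.
move=> b1 c0 c1 d0 K0 P0 N0 Nle p0 lp hD.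
have b0 : 0 < b by apply: lt_le_trans b1.
pose B := b ^+ l; have B1 : 1 <= B by apply: exprn_ege1.
have B0 : 0 < B by apply: lt_le_trans B1.
have E2 : b ^+ (2 * l) = B ^+ 2 by rewrite mulnC exprM.
have E3 : b ^+ (3 * l) = B ^+ 3 by rewrite mulnC exprM.
have El : b ^+ l.+1 = b * B by rewrite exprS.
rewrite E2 E3 El in Nle hD *.
have t4 : 0 < 4 ^+ k :> R by rewrite exprn_gt0.
have t2 : 0 < 2 ^+ k :> R by rewrite exprn_gt0.
have t8 : 8 ^+ k = 2 ^+ k * 4 ^+ k :> R by rewrite -exprMn -natrM.
have M1 : c * (delta / (2 * K * 4 ^+ k)) * (B ^+ 2 / b ^+ 2) <= c / (b * B) * delta * D.
  have -> : c * (delta / (2 * K * 4 ^+ k)) * (B ^+ 2 / b ^+ 2)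
      = c / (b * B) * delta * (B ^+ 3 / (2 * K * 4 ^+ k * b)).
    by field; rewrite !gt_eqF.
  have s0 : 0 <= c / (b * B) * delta by rewrite mulr_ge0 ?divr_ge0 ?mulr_ge0 // ltW.
  by rewrite ler_wpM2l // ler_pdivrMr ?mulr_gt0 // mulrC.
have M2 : B ^+ 3 * (2 ^+ k * (4 ^+ k * (c / (b * B)) ^+ 2)) <= c ^+ 2 * 8 ^+ k * (B ^+ 2 / b ^+ 2).
  have -> : B ^+ 3 * (2 ^+ k * (4 ^+ k * (c / (b * B)) ^+ 2)) = c ^+ 2 * 8 ^+ k * (B / b ^+ 2).
    by rewrite t8; field; rewrite !gt_eqF.
  have s0 : 0 <= c ^+ 2 * 8 ^+ k by rewrite mulr_ge0 ?exprn_ge0 // ltW.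
  have s1 : 0 <= (b ^+ 2)^-1 by rewrite invr_ge0 exprn_ge0 // ltW.
  rewrite (ler_wpM2l s0) // (ler_wpM2r s1) //.
  by rewrite expr2 ler_peMl // ltW.
have M3 : B ^+ 3 * ((c / (b * B)) ^+ p.*2 * N ^+ p) <= c ^+ 2 * (2 ^+ k) ^+ p * (B ^+ 2 / b ^+ 2).
  have h1 : (c / (b * B)) ^+ p.*2 * N ^+ p <= ((c / b) ^+ 2 * 2 ^+ k) ^+ p.
    have s0 : 0 <= (c / (b * B)) ^+ 2 * N by rewrite mulr_ge0 ?sqr_ge0.
    have s1 : 0 <= (c / b) ^+ 2 * 2 ^+ k by rewrite mulr_ge0 ?sqr_ge0 // ltW.
    rewrite -mul2n exprM -exprMn lerXn2r ?nnegrE //.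
    apply: le_trans (ler_wpM2l (sqr_ge0 _) Nle) _.
    rewrite le_eqVlt; apply/orP; left; apply/eqP; field.
    by rewrite !gt_eqF.
  apply: le_trans (ler_wpM2l _ h1) _; first by rewrite exprn_ge0 // ltW.
  have hc : (c ^+ 2) ^+ p <= c ^+ 2.
    by rewrite -exprM; apply: ler_wiXn2l; rewrite ?(ltW c0) // leq_pmulr.
  (* Each factor [eta ^+ 2 * N] saves [b ^+ 2]; with [l.+2 <= p.*2], [p] of them absorb the excess
     [b ^+ l]. *)
  have hb : B / b ^+ p.*2 <= (b ^+ 2)^-1.
    rewrite ler_pdivrMr ?exprn_gt0 // mulrC ler_pdivlMr ?exprn_gt0 //.
    by rewrite /B -exprD ler_weXn2l // addn2.
  have hcb : (c ^+ 2) ^+ p * (B / b ^+ p.*2) <= c ^+ 2 * (b ^+ 2)^-1.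
    have s0 : 0 <= (c ^+ 2) ^+ p by rewrite exprn_ge0 // sqr_ge0.
    have s1 : 0 <= B / b ^+ p.*2 by rewrite divr_ge0 ?exprn_ge0 // ltW.
    exact: ler_pM.
  have -> : B ^+ 3 * ((c / b) ^+ 2 * 2 ^+ k) ^+ p = (2 ^+ k) ^+ p * B ^+ 2 * ((c ^+ 2) ^+ p *
    (B / b ^+ p.*2)).
    rewrite -mul2n exprM exprMn expr_div_n exprMn exprVn.
    by move: (_ ^+ p) (_ ^+ p) (_ ^+ p) => x y w; ring.
  have -> : c ^+ 2 * (2 ^+ k) ^+ p * (B ^+ 2 / b ^+ 2) = (2 ^+ k) ^+ p * B ^+ 2 * (c ^+ 2 * (b
    ^+ 2)^-1).
    by ring.
  have s0 : 0 <= (2 ^+ k) ^+ p * B ^+ 2 by rewrite mulr_ge0 ?sqr_ge0 // exprn_ge0 // ltW.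
  exact: ler_wpM2l.
have kP : 0 <= 2 ^+ k * k%:R * P by rewrite !mulr_ge0 // ltW.
have := ler_wpM2l kP M3; lra.
Qed.

Lemma sum_degree1 (V : finType) (k : nat) (E : {set {set V}}) : uniform k E ->
  (\sum_v degree E [set v] = k * #|E|)%N.
Proof.
move=> Ek; rewrite mulnC -sum_nat_const.
rewrite (eq_bigr (fun v => \sum_(e in E) (v \in e)))%N; last first.
  move=> v _; rewrite /degree -sum1_card big_mkcond [RHS]big_mkcond; apply: eq_bigr => e _.
  by rewrite inE sub1set; case: (e \in E); case: (v \in e).
rewrite exchange_big; apply: eq_bigr => e eE.
by rewrite -(Ek e eE) -sum1_card [RHS]big_mkcond.
Qed.

Lemma card_high_degree (R : realType) (V : finType) (k : nat) (E : {set {set V}}) (a : R) :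
  uniform k E -> 0 <= a ->
  a * (#|[set v | a < (degree E [set v])%:R]|)%:R <= k%:R * (#|E|)%:R.
Proof.
move=> Ek a0; rewrite -natrM -(sum_degree1 Ek) -sum1_card !natr_sum mulr_sumr.
rewrite big_mkcond; apply: ler_sum => v _; rewrite inE mulr1.
by case: ifP => // /ltW.
Qed.

Lemma card_subsets_through (V : finType) (k : nat) (E F : {set {set V}}) (v : V) :
  uniform k E -> {in F, forall T : {set V}, v \in T /\ exists2 e, e \in E & T \subset e} ->
  (#|F| <= 2 ^ k * degree E [set v])%N.
Proof.
move=> Ek FE; rewrite mulnC -sum_nat_const -sum1_card.
apply: (@leq_trans (\sum_(T in F) \sum_(e in [set e in E | [set v] \subset e]) (T \subset e))%N).
  apply: leq_sum => T TF; have [vT [e eE Te]] := FE T TF.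
  by rewrite (bigD1 e) ?Te //= inE eE sub1set (subsetP Te).
rewrite exchange_big; apply: leq_sum => e; rewrite inE => /andP[eE _].
rewrite -(Ek e eE) -card_powerset -big_mkcondr sum1dep_card; apply: subset_leq_card.
by apply/subsetP => T; rewrite !inE => /andP[].
Qed.

(** * The cases of many and of few heavy edges *)

Section Gain.
Variables (R : realType) (V : finType) (r k q l : nat) (E : {set {set V}}) (b : R).
(** Large enough for both [l.+2 <= p.*2], needed against the truncation error, and [q.+2 <= p.*2],
    needed in [large_term]. *)
Let p := (l + q + 2)%N.
Hypotheses (Ek : uniform k E) (E0 : (0 < #|E|)%N) (l0 : (0 < l)%N).
Hypotheses (b1 : 1 <= b) (bE : b ^+ (3 * l) = (#|E|)%:R).
Hypotheses (k_large : (p.*2 ^ (3 * l) + q + 2 <= k)%N).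
Hypotheses (kr : (k <= r.+1 + q)%N) (rk : (r.+1 <= k)%N).

Let delta : R := r.+1%:R ^- k.
Let W := [set v | b ^+ (2 * l) < (degree E [set v])%:R].
Let heavy := [set e in E | (1 < #|W :&: e|)%N].

Definition heavy_const : R := delta ^+ 2 / (128 * 2 ^+ k * k%:R).
Definition light_lin : R := delta / (2 * (3 * l)%:R * 4 ^+ k).
Definition light_quad : R := 8 ^+ k + 2 ^+ k * k%:R * (p ^ p.*2)%:R * (2 ^+ k) ^+ p.

Let b0 : 0 < b. Proof. exact: lt_le_trans ltr01 b1. Qed.

Let k0 : (0 < k)%N. Proof. by apply: leq_trans k_large; rewrite addn2. Qed.

Let delta0 : 0 < delta. Proof. by rewrite invr_gt0 exprn_gt0 ?ltr0n. Qed.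

Let delta1 : delta <= 1.
Proof. by rewrite invf_le1 ?exprn_gt0 ?ltr0n // exprn_ege1 // ler1n. Qed.

(** Counting incidences gives [#|W| <= k * b ^+ l], so [#|heavy| / #|W|] is at least
    [b ^+ (2 * l) / (2 * k)]. *)
Lemma heavy_case : (#|E| <= 2 * #|heavy|)%N -> exists x : {ffun V -> 'I_r.+1},
  \sum_(e in E) avg (fun x : {ffun V -> 'I_r.+1} => (rainbow e x)%:R) + heavy_const * (b ^+ (2
    * l) / b ^+ 2)
  <= (#|[set e in E | rainbow e x]|)%:R.
Proof.
move=> hE; have r2 : (1 < r.+1)%N by move: k_large (expn_gt0 p.*2 (3 * l)); lia.
have [x hx] := heavy_gain R W Ek r2 rk.
exists x; apply: le_trans hx; rewrite lerD2l -/delta -/heavy.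
have Wle := card_high_degree Ek (exprn_ge0 (2 * l) (ltW b0)); rewrite -/W -bE in Wle.
have W0 : (0 < #|W|)%N.
  have : (0 < #|heavy|)%N by move: hE E0; lia.
  case/card_gt0P => e; rewrite inE => /andP[_ We].
  by apply: leq_trans (subset_leq_card (subsetIl W e)); apply: leq_trans We.
have W0' : 0 < (#|W|)%:R :> R by rewrite ltr0n.
have hE' : b ^+ (3 * l) <= 2 * (#|heavy|)%:R :> R by rewrite bE -natrM ler_nat.
have bl : b ^+ (3 * l) = b ^+ (2 * l) * b ^+ l by rewrite -exprD; congr (_ ^+ _); lia.
have Wle' : (#|W|)%:R <= k%:R * b ^+ l.
  by rewrite -(ler_pM2l (exprn_gt0 (2 * l) b0)) mulrCA -bl.
have kR : 0 < k%:R :> R by rewrite ltr0n.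
have t2 : 0 < 2 ^+ k :> R by rewrite exprn_gt0.
rewrite /heavy_const (_ : delta ^+ 2 / (128 * 2 ^+ k * k%:R) = delta ^+ 2 / (64 * 2 ^+ k) * (2
  * k%:R)^-1); last first.
  by field; rewrite !gt_eqF.
rewrite -mulrA ler_wpM2l //.
  by rewrite divr_ge0 ?sqr_ge0 // mulr_ge0 // ltW.
have B2 : 1 <= b ^+ 2 by rewrite exprn_ege1.
have Bl : 0 < b ^+ (2 * l) by rewrite exprn_gt0.
apply: (@le_trans _ _ ((2 * k%:R)^-1 * b ^+ (2 * l))).
  rewrite ler_wpM2l ?invr_ge0 ?mulr_ge0 ?(ltW kR) //.
  by rewrite ler_pdivrMr ?(lt_le_trans ltr01) // ler_peMr // ltW.
rewrite ler_pdivlMr // -mulrA mulrC ler_pdivrMr ?mulr_gt0 //.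
have h1 := ler_wpM2l (ltW Bl) Wle'; have h2 := ler_wpM2l (ltW kR) hE'.
rewrite bl in h2; lra.
Qed.

Lemma light_case (c : R) : 0 < c -> c * 2 ^+ k <= 1 -> (#|heavy| <= #|E :\: heavy| )%N ->
  exists x : {ffun V -> 'I_r.+1},
  \sum_(e in E) avg (fun x : {ffun V -> 'I_r.+1} => (rainbow e x)%:R)
    + (c * light_lin - c ^+ 2 * light_quad) * (b ^+ (2 * l) / b ^+ 2)
  <= (#|[set e in E | rainbow e x]|)%:R.
Proof.
move=> c0 c2 hE; set E1 := E :\: heavy in hE.
have E1E : E1 \subset E by apply: subsetDl.
have E1half : (#|E| <= 2 * #|E1|)%N.
  by rewrite (cardsD E heavy) in hE *; have := subset_leq_card (subsetIr E heavy); lia.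
have L0 : (0 < 3 * l)%N by lia.
have p0 : (0 < p)%N by rewrite /p addn2.
have Q0 : (0 < p.*2)%N by rewrite double_gt0.
have QLk : (p.*2 ^ (3 * l) <= k)%N by move: k_large; lia.
have EbL : (#|E|)%:R <= b ^+ (3 * l) by rewrite bE.
have [j [F0 [jL F0card F0E1 F0sparse F0deg]]] := sparse_family Ek E1E b1 EbL L0 Q0 QLk.
set rho := (p.*2 ^ j)%N in F0sparse; pose h := (p * rho)%N.
have rho0 : (0 < rho)%N by rewrite expn_gt0 Q0.
have hE2 : (p.*2 ^ j.+1 = h.*2)%N by rewrite expnS -doubleMl.
have h0 : (0 < h)%N by rewrite muln_gt0 p0.
have hr : (h.*2 <= r.+1)%N.
  rewrite -hE2; have : (p.*2 ^ j.+1 <= p.*2 ^ (3 * l))%N by rewrite leq_pexp2l.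
  move=> h1; apply: leq_trans h1 _; rewrite -(leq_add2r q); apply: leq_trans kr.
  by apply: leq_trans k_large; rewrite leq_addr.
have [e0 e0E] : exists e, e \in E by apply/card_gt0P.
have [v0 _] : exists v, v \in e0 by apply/card_gt0P; rewrite (Ek e0E).
(* Members of [F0] have at least two vertices and lie in edges with at most one in [W], so the
   default [v0] does not occur on them. The low degree of [u T] bounds [N]. *)
pose u (T : {set V}) := odflt v0 [pick v in T :\: W].
have uP T : T \in F0 -> u T \in T :\: W.
  move=> TF; rewrite /u; case: pickP => // none; exfalso.
  have [e] := F0E1 T TF; rewrite !inE => /andP[+ eE] Te; rewrite eE /= => /negP; apply.
  have TW : T \subset W :&: e.
    rewrite subsetI Te andbT; apply/subsetP => v vT.
    by have := none v; rewrite inE vT andbT => /negbFE.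
  apply: leq_trans (subset_leq_card TW); rewrite F0card // hE2.
  by move: h0; case: (h) => // n _; rewrite doubleS.
have uT T : T \in F0 -> u T \in T by move/uP; rewrite inE => /andP[].
have Tk T : T \in F0 -> (#|T| <= k)%N.
  move=> /F0E1[e eE1 Te]; rewrite -(Ek (subsetP E1E _ eE1)).
  exact: subset_leq_card.
(* Weighting by degree loses at most a factor [2 ^ k] of the degree sum, which measures the gain. *)
have [A hA] := @exists_trace V _ (mem F0) (degree E) id u k uT Tk.
pose F := [set T in F0 | T :&: A == [set u T]].
have FF0 T : T \in F -> T \in F0 by rewrite inE => /andP[].
have Fcard : {in F, forall T : {set V}, #|T| = h.*2}.
  by move=> T /FF0 TF; rewrite F0card.
have Ftrace : {in F, forall T : {set V}, T :&: A = [set u T]}.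
  by move=> T; rewrite inE => /andP[_ /eqP].
have Fsparse : {in F &, forall T T' : {set V}, T != T' -> (#|T :&: T'| < rho)%N}.
  by move=> T T' /FF0 TF /FF0 T'F; apply: F0sparse.
pose N := \max_v #|[set T in F | u T == v]|.
have FN v : (#|[set T in F | u T == v]| <= N)%N by apply: leq_bigmax.
have Nle : N%:R <= 2 ^+ k * b ^+ (2 * l).
  rewrite /N; have [|v ->] := @bigop.eq_bigmax V (fun v => #|[set T in F | u T == v]|); first
    by apply/card_gt0P; exists v0.
  have [->|[T]] := set_0Vmem [set T in F | u T == v].
    by rewrite cards0 mulr_ge0 // exprn_ge0 // ltW.
  rewrite inE => /andP[/FF0 TF /eqP uTv]; have := uP _ TF.
  rewrite uTv !inE -leNgt => /andP[vle _]; apply: (le_trans _ (ler_wpM2l _ vle)); last by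
    rewrite exprn_ge0.
  rewrite -natrX -natrM ler_nat; apply: card_subsets_through Ek _ => S.
  rewrite inE => /andP[/FF0 SF /eqP <-]; split; first exact: uT.
  by have [e eE1 Se] := F0E1 S SF; exists e => //; apply: (subsetP E1E).
pose eta := c / b ^+ l.+1.
have bl1 : 1 <= b ^+ l.+1 by rewrite exprn_ege1.
have bl0 : 0 < b ^+ l.+1 by rewrite exprn_gt0.
have eta0 : 0 < eta by rewrite divr_gt0.
have eta1 : eta * 2 ^+ k <= 1.
  apply: le_trans c2; rewrite ler_wpM2r ?exprn_ge0 // ler_pdivrMr //.
  by rewrite ler_peMr // ltW.
have qp : (q.+2 <= p.*2)%N.
  rewrite -addnn; apply: leq_trans (leq_addr _ _).
  by rewrite /p -[q.+2]addn2 leq_add2r leq_addl.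
have rhoh : (p.*2 * rho <= h.*2)%N by rewrite /h doubleMl.
have [x hx] := sparse_gain Ek rk kr qp h0 hr rho0 rhoh Fcard Ftrace Fsparse FN eta0 eta1.
exists x; apply: le_trans hx; rewrite -addrA lerD2l -/delta.
set D := (\sum_(T in F) degree E T)%N.
have hD : b ^+ (3 * l) <= 2 * (3 * l)%:R * 4 ^+ k * b * D%:R.
  have hA' : (\sum_(T in F0) degree E T)%:R <= 2 ^+ k * D%:R :> R.
    rewrite -natrX -natrM ler_nat; apply: leq_trans hA _.
    by apply: eq_leq; rewrite /D; congr (_ * _)%N; apply: eq_bigl => T; rewrite [RHS]inE.
  rewrite bE; apply: (@le_trans _ _ (2 * (#|E1|)%:R)); first by rewrite -natrM ler_nat.
  have cst : 0 <= (3 * l)%:R * 2 ^+ k * b by rewrite !mulr_ge0 ?exprn_ge0 // ltW.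
  have := ler_wpM2l cst hA'; have -> : 4 ^+ k = 2 ^+ k * 2 ^+ k :> R.
    by rewrite -exprMn -natrM.
  move: F0deg; lra.
have c1 : c <= 1.
  by apply: le_trans c2; rewrite ler_peMr ?exprn_ege1 ?ler1n // ltW.
have lp : (l.+2 <= p.*2)%N.
  rewrite -addnn; apply: leq_trans (leq_addr _ _).
  by rewrite /p -[l.+2]addn2 leq_add2r leq_addr.
have L0' : 0 < (3 * l)%:R :> R by rewrite ltr0n.
have P0 : 0 <= (p ^ p.*2)%:R :> R by [].
have N0 : 0 <= N%:R :> R by [].
have := gain_arithmetic b1 c0 c1 delta0 L0' P0 N0 Nle p0 lp hD.
by rewrite bE (natrM _ (p ^ p.*2)) (natrX _ N).
Qed.
End Gain.

(** * From rainbow colourings to surplus *)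

Lemma stirling2_avg (R : realType) (V : finType) (r : nat) (e : {set V}) :
  (stirling2 #|e| r.+1 * r.+1`!)%:R / r.+1%:R ^+ #|e|
    <= avg (fun x : {ffun V -> 'I_r.+1} => (rainbow e x)%:R) :> R.
Proof.
have -> : avg (fun x : {ffun V -> 'I_r.+1} => (rainbow e x)%:R)
    = (#|[set x : {ffun V -> 'I_r.+1} | rainbow e x]|)%:R / r.+1%:R ^+ #|V| :> R.
  rewrite /avg card_ffun card_ord natrX; congr (_ / _).
  rewrite -sum1_card natr_sum [RHS]big_mkcond; apply: eq_bigr => x _.
  by rewrite inE; case: ifP.
rewrite ler_pdivrMr ?exprn_gt0 ?ltr0n // mulrAC ler_pdivlMr ?exprn_gt0 ?ltr0n //.
rewrite -!natrX -!natrM ler_nat; have := stirling2_rainbow e (ltn0Sn r).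
rewrite -(@leq_pmul2r (r.+1 ^ #|e|)) ?expn_gt0 // -mulnA -expnD subnK ?max_card //.
Qed.

Section Surplus.
Variables (R : realType) (V : finType) (r k q l : nat) (E : {set {set V}}) (b : R).
Hypotheses (Ek : uniform k E) (E0 : (0 < #|E|)%N) (l0 : (0 < l)%N).
Hypotheses (b1 : 1 <= b) (bE : b ^+ (3 * l) = (#|E|)%:R).
Hypotheses (k_large : ((l + q + 2).*2 ^ (3 * l) + q + 2 <= k)%N).
Hypotheses (kr : (k <= r.+1 + q)%N) (rk : (r.+1 <= k)%N).

(** The second entry is the maximum over [c] of [c * light_lin - c ^+ 2 * light_quad], attained at
    [light_lin / (2 * light_quad)]. *)
Definition gain_const : R := Num.min (heavy_const R r k)
  (light_lin R r k l ^+ 2 / (4 * light_quad R k q l)).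

Let kR : 0 < k%:R :> R.
Proof. by rewrite ltr0n; apply: leq_trans rk. Qed.

Let lin0 : 0 < light_lin R r k l.
Proof.
by rewrite divr_gt0 ?invr_gt0 ?mulr_gt0 ?exprn_gt0 ?ltr0n // muln_gt0.
Qed.

Let quad2 : 2 ^+ k <= light_quad R k q l.
Proof.
apply: (@le_trans _ _ (8 ^+ k)); first by rewrite lerXn2r ?nnegrE // ler_nat.
by rewrite lerDl !mulr_ge0 ?exprn_ge0.
Qed.

Let quad0 : 0 < light_quad R k q l.
Proof. by apply: lt_le_trans quad2; rewrite exprn_gt0. Qed.

Lemma gain_const_gt0 : 0 < gain_const.
Proof.
rewrite lt_min; apply/andP; split.
  have d0 : 0 < r.+1%:R ^- k :> R by rewrite invr_gt0 exprn_gt0 ?ltr0n.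
  apply: divr_gt0; first by rewrite exprn_gt0.
  by apply: mulr_gt0 => //; apply: mulr_gt0 => //; rewrite exprn_gt0.
by apply: divr_gt0; [apply: exprn_gt0 | apply: mulr_gt0].
Qed.

Lemma exists_cut_surplus : exists2 P : {set {set V}}, is_cut r.+1 P &
  gain_const * (b ^+ (2 * l) / b ^+ 2) <= surplus R k r.+1 E P.
Proof.
have b0 : 0 < b := lt_le_trans ltr01 b1.
have X0 : 0 < b ^+ (2 * l) / b ^+ 2 by rewrite divr_gt0 ?exprn_gt0.
have [x hx] : exists x : {ffun V -> 'I_r.+1},
    \sum_(e in E) avg (fun x : {ffun V -> 'I_r.+1} => (rainbow e x)%:R)
      + gain_const * (b ^+ (2 * l) / b ^+ 2) <= (#|[set e in E | rainbow e x]|)%:R.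
  set heavy := [set e in E | (1 < #|[set v | (b ^+ (2 * l) < (degree E [set v])%:R)%R] :&: e|)%N].
  have heavyE : heavy \subset E by apply/subsetP => e; rewrite inE => /andP[].
  have cE : (#|E| = #|heavy| + #|E :\: heavy|)%N by rewrite -(cardsID heavy E) (setIidPr heavyE).
  have [hl|hl] := leqP #|heavy| #|E :\: heavy|.
    pose c := light_lin R r k l / (2 * light_quad R k q l).
    have c0 : 0 < c by apply: divr_gt0 => //; apply: mulr_gt0.
    have lin1 : light_lin R r k l <= 1.
      have d1 : r.+1%:R ^- k <= 1 :> R.
        by rewrite invf_le1 ?exprn_gt0 ?ltr0n // exprn_ege1 // ler1n.
      have h4 : 1 <= 4 ^+ k :> R by rewrite exprn_ege1 // ler1n.
      have h3 : 1 <= (3 * l)%:R :> R by rewrite ler1n muln_gt0.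
      have h5 : 1 <= 2 * (3 * l)%:R * 4 ^+ k :> R by nra.
      by rewrite /light_lin ler_pdivrMr ?(lt_le_trans ltr01) // mul1r (le_trans d1).
    have c2 : c * 2 ^+ k <= 1.
      rewrite /c mulrAC ler_pdivrMr; last exact: mulr_gt0.
      rewrite mul1r.
      apply: (@le_trans _ _ (1 * 2 ^+ k)); first by rewrite ler_wpM2r ?exprn_ge0.
      by rewrite mul1r; move: quad2 quad0; lra.
    have [x hx] := light_case Ek E0 l0 b1 bE k_large kr rk c0 c2 hl.
    exists x; apply: le_trans hx; rewrite lerD2l ler_wpM2r ?(ltW X0) //.
    rewrite /gain_const ge_min; apply/orP; right; rewrite le_eqVlt; apply/orP; left.
    by apply/eqP; rewrite /c; field; rewrite gt_eqF.
  have [|x hx] := heavy_case Ek E0 l0 b1 bE k_large kr rk.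
    by rewrite -/heavy cE; lia.
  exists x; apply: le_trans hx; rewrite lerD2l ler_wpM2r ?(ltW X0) //.
  by rewrite /gain_const ge_min lexx.
have avgE : (stirling2 k r.+1 * r.+1`!)%:R / r.+1%:R ^+ k * (#|E|)%:R
    <= \sum_(e in E) avg (fun x : {ffun V -> 'I_r.+1} => (rainbow e x)%:R) :> R.
  rewrite -sum1_card natr_sum mulr_sumr; apply: ler_sum => e eE.
  by rewrite mulr1 -(Ek eE) stirling2_avg.
have gX := mulr_gt0 gain_const_gt0 X0.
have A0 : 0 <= \sum_(e in E) avg (fun x : {ffun V -> 'I_r.+1} => (rainbow e x)%:R) :> R.
  apply: le_trans avgE; rewrite mulr_ge0 // divr_ge0 // exprn_ge0 //.
(* A rainbow edge is needed to make all parts of the cut nonempty. *)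
have : (0 < #|[set e in E | rainbow e x]|)%N by rewrite -(ltr0n R); lra.
case/card_gt0P => e; rewrite inE => /andP[_ ex].
have [P Pcut Psize] := cut_of_coloring E ex.
by exists P => //; rewrite /surplus Psize; lra.
Qed.
End Surplus.

(** Makes the constant independent of [q] and [r], since finitely many pairs matter for each [k]. *)
Lemma common_lower_bound (R : realFieldType) (P : nat -> R -> Prop) (n : nat) :
    (forall i c d, 0 < c -> c <= d -> P i d -> P i c) ->
    (forall i, exists2 c, 0 < c & P i c) ->
  exists2 c, 0 < c & forall i, (i < n)%N -> P i c.
Proof.
move=> mono ex; elim: n => [|n [c c0 hc]]; first by exists 1.
have [d d0 hd] := ex n; have m0 : 0 < Num.min c d by rewrite lt_min c0.
exists (Num.min c d) => // i; rewrite ltnS leq_eqVlt => /orP[/eqP->|ni].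
  by apply: mono hd; rewrite // ge_min lexx orbT.
by apply: mono (hc i ni); rewrite // ge_min lexx.
Qed.

(** With [b] the [3 l]-th root of [m], the right-hand exponent is [2/3 - 2/(3 l)], at least
    [2/3 - eps] as [1 / l <= eps]. *)
Lemma cube_root_power (R : realType) (m l : nat) (eps : R) : (0 < m)%N -> (0 < l)%N ->
    eps^-1 <= l%:R -> 0 < eps ->
  exists b : R, [/\ 1 <= b, b ^+ (3 * l) = m%:R &
    m%:R `^ (2%:R / 3%:R - eps) <= b ^+ (2 * l) / b ^+ 2].
Proof.
move=> m0 l0 le eps0; have m1 : 1 <= m%:R :> R by rewrite ler1n.
have mp : 0 < m%:R :> R by rewrite ltr0n.
have lR : 0 < l%:R :> R by rewrite ltr0n.
pose b : R := m%:R `^ (3 * l)%:R^-1.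
have bX n : b ^+ n = m%:R `^ (n%:R / (3 * l)%:R).
  by rewrite -powR_mulrn ?powR_ge0 // -powRrM mulrC.
exists b; split.
- have h : 0 <= (3 * l)%:R^-1 :> R by rewrite invr_ge0.
  by have := ler_powR m1 h; rewrite powRr0.
- rewrite bX divff; first by apply: powRr1; apply: ltW.
  by rewrite pnatr_eq0 -lt0n muln_gt0.
rewrite !bX -powRN -powRD; last by rewrite (gt_eqF mp) implybT.
apply: ler_powR => //; rewrite !natrM.
have -> : 2 * l%:R / (3 * l%:R) - 2 / (3 * l%:R) = 2 / 3 - (2 / 3) * l%:R^-1 :> R.
  by field; rewrite gt_eqF.
have : l%:R^-1 <= eps by rewrite -[eps]invrK lef_pV2 ?posrE ?invr_gt0.
have : 0 < l%:R^-1 :> R by rewrite invr_gt0.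
lra.
Qed.

Theorem theorem7p8 (R : realType) (eps : R) (eps_gt0 : 0 < eps) :
  exists2 c : nat -> R, (forall k : nat, 0 < c k) &
    forall q : nat, (0 < q)%N ->
    exists k0 : nat, forall k r : nat,
      (k0 <= k)%N -> (k - q <= r)%N -> (r <= k)%N ->
    forall (T : finType) (E : {set {set T}}),
      uniform k E -> (0 < #|E|)%N ->
    exists2 P : {set {set T}}, is_cut r P &
      c k * (#|E|%:R `^ (2%:R / 3%:R - eps)) <= surplus R k r E P.
Proof.
pose l := Num.bound eps^-1.
have lgt : eps^-1 < l%:R by apply: archi_boundP; rewrite invr_ge0 ltW.
have l0 : (0 < l)%N by rewrite -(ltr0n R); apply: lt_trans lgt; rewrite invr_gt0.
pose threshold q := ((l + q + 2).*2 ^ (3 * l) + q + 2)%N.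
pose good k q r c := (threshold q <= k)%N -> (k - q <= r)%N -> (r <= k)%N ->
  forall (T : finType) (E : {set {set T}}), uniform k E -> (0 < #|E|)%N ->
  exists2 P : {set {set T}}, is_cut r P &
    c * (#|E|%:R `^ (2%:R / 3%:R - eps)) <= surplus R k r E P.
have good_mono k q r c d : 0 < c -> c <= d -> good k q r d -> good k q r c.
  move=> c0 cd gd h1 h2 h3 T E Ek E0; have [P Pcut hP] := gd h1 h2 h3 T E Ek E0.
  by exists P => //; apply: le_trans hP; rewrite ler_wpM2r ?powR_ge0.
have good_ex k q r : exists2 c, 0 < c & good k q r c.
  have [h1|h1] := boolP (threshold q <= k)%N; last by exists 1 => // h; rewrite h in h1.
  have [h2|h2] := boolP (k - q <= r)%N; last by exists 1 => // _ h; rewrite h in h2.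
  have [h3|h3] := boolP (r <= k)%N; last by exists 1 => // _ _ h; rewrite h in h3.
  (* [r = 0] is impossible because [threshold q] exceeds [q]. *)
  case: r h2 h3 => [|r] h2 h3; first by move: h1 h2; rewrite /threshold; lia.
  exists (gain_const R r k q l); first exact: (@gain_const_gt0 R r k q l l0 h3).
  move=> _ _ _ T E Ek E0; have [b [b1 bE hb]] := cube_root_power E0 l0 (ltW lgt) eps_gt0.
  have kr : (k <= r.+1 + q)%N by rewrite addnC -leq_subLR.
  have [P Pcut hP] := exists_cut_surplus Ek E0 l0 b1 bE h1 kr h3.
  exists P => //; apply: le_trans hP; rewrite ler_wpM2l //.
  by rewrite ltW // (@gain_const_gt0 R r k q l l0 h3).
(* The range [q <= k] suffices because [q <= threshold q]. *)
have exc k : exists c, 0 < c /\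
    forall q r, (q < k.+1)%N -> (r < k.+1)%N -> good k q r c.
  have [|q|c c0 hc] := @common_lower_bound R (fun q c => forall r, (r < k.+1)%N -> good k q r
    c) k.+1.
  - by move=> q c d c0 cd gd r rk; apply: good_mono (gd r rk).
  - by apply: common_lower_bound => // r c d; apply: good_mono.
  by exists c; split=> // q r qk rk; apply: hc.
have [c hc] := choice exc.
exists c => [k|q _]; first by have [] := hc k.
exists (threshold q) => k r kq qr rk T E Ek E0; have [_ gk] := hc k.
have qk : (q < k.+1)%N by rewrite ltnS; apply: leq_trans kq; rewrite /threshold -addnA
  (leq_trans (leq_addr 2 q)) ?leq_addl.
exact: (gk q r qk rk kq qr rk T E Ek E0).
Qed.
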